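(* Let $1\le p\le 2$ and let $p'$ be the conjugate exponent, $p^{-1}+p'^{-1}=1$ (with $p'=\infty$ if $p=1$). There is a constant $K_4$, depending only on $p$, such that for every $f\in L^p(\mathbb{R}_+)$, $$ \|\hat{\mathcal L} f\|_{p'}\le K_4\,\|f\|_{p}, $$ where the norm on the left is that of $L^{p'}(\mathbb{R}_+)$ and the norm on the right is that of $L^p(\mathbb{R}_+)$.
   Context: Here $\mathbb{R}_+=(0,\infty)$ with Lebesgue measure, and functions are measurable and complex-valued. For $f$ on $\mathbb{R}_+$, the Laplace transform is the analytic function in the right half-plane $\{z:\operatorname{Re} z>0\}$ given by $$ \mathcal L f(z)=\int_0^\infty f(t)e^{-zt}\,dt . $$ The angular maximal Laplace transform $\hat{\mathcal L}$ sends $f$ to the function of $\rho\in\mathbb{R}_+$ with values in $[0,\infty]$, $$ \hat{\mathcal L} f(\rho)=\sup_{|\theta|<\pi/2}\left|\mathcal L f(\rho e^{i\theta})\right|=\sup_{|\theta|<\pi/2}\left|\int_0^\infty e^{-t\rho e^{i\theta}}f(t)\,dt\right| . $$ *)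

(* Defs.v *)
From HB Require Import structures.
From mathcomp Require Import all_boot all_order all_algebra.
From mathcomp Require Import complex.
From mathcomp Require Import all_classical all_reals all_analysis.

Set Implicit Arguments.
Unset Strict Implicit.
Unset Printing Implicit Defensive.
Import Order.TTheory GRing.Theory Num.Theory.
Import numFieldNormedType.Exports.

Local Open Scope classical_set_scope.
Local Open Scope complex_scope.
Local Open Scope ring_scope.

Section AngularMaximalLaplace.
Context {R : realType}.
Implicit Types (f : R -> R[i]) (z : R[i]) (p : \bar R).

Definition Rpos : set R := `]0, +oo[.

Definition cabs z : R := ComplexField.Normc.normc z.

Definition cexp z : R[i] :=
  (expR (complex.Re z) * cos (complex.Im z)) +i*
  (expR (complex.Re z) * sin (complex.Im z)).

(* Only the values on (0, +oo) matter; the components of the integral are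
   [fine] of extended-real integrals, hence meaningful when the integrand is
   integrable, as it is for Re z > 0 and f in L^p(0, +oo), 1 <= p. *)
Definition laplace f z : R[i] :=
  (\int[lebesgue_measure]_(t in Rpos) complex.Re (f t * cexp (- (z * t%:C)))) +i*
  (\int[lebesgue_measure]_(t in Rpos) complex.Im (f t * cexp (- (z * t%:C)))).

Definition angular_max_laplace f (rho : R) : \bar R :=
  ereal_sup [set (cabs (laplace f (rho%:C * cexp (0 +i* theta))))%:E
            | theta in [set theta : R | `|theta| < pi / 2]].

(* L^p(0, +oo) norm, as the L^p norm on the line of the extension by 0; for
   p = +oo this is again the essential supremum over (0, +oo), because
   (0, +oo) has positive measure and [Lnorm] takes absolute values. *)
Definition Lnorm_pos p (g : R -> \bar R) : \bar R :=
  Lnorm lebesgue_measure p (g \_ Rpos).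

Definition Lp_pos p f : Prop :=
  [/\ measurable_fun Rpos (fun t => complex.Re (f t)),
      measurable_fun Rpos (fun t => complex.Im (f t))
    & (Lnorm_pos p (fun t => (cabs (f t))%:E) < +oo)%E].

End AngularMaximalLaplace.

(* Main.v *)
Require Import Defs.
From mathcomp Require Import all_boot all_order all_algebra.
From mathcomp Require Import complex.
From mathcomp Require Import all_classical all_reals all_analysis.
From mathcomp Require Import measurable_realfun ess_sup_inf ring lra.
Import Order.TTheory GRing.Theory Num.Theory.
Import numFieldNormedType.Exports.
Set Implicit Arguments.
Unset Strict Implicit.
Unset Printing Implicit Defensive.
Local Open Scope classical_set_scope.
Local Open Scope ring_scope.

(** For p = 1 the estimate is |exp(- t z)| <= 1.  For 1 < p <= 2 the boundary
values of the Laplace transform on the imaginary axis are Fourier transforms,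
so that the statement contains both the Hausdorff-Young inequality and a
maximal inequality.  A single positivity argument gives them together, with
neither Fourier inversion nor the Hardy-Littlewood maximal function.

Linearization.  The supremum over an arc is the increasing limit of maxima over
finitely many angles of a dense sequence.  A maximum over finitely many angles
is attained at an angle th(rho) that depends measurably on rho
([best_angle], [angular_max_best]).  It is then enough to bound, with constants
that do not depend on the choice of th, the linear operators
    T u(rho) = \int u(t) exp(- t x(rho)) cos(t y(rho)) dt   (and with sin),
where u is real, x + i y = z(rho) = rho exp(i th(rho)), and rho runs over a
compact interval of (0, +oo), on which x is bounded below.

The case p = 2.  By duality ([kernel_op_L2]) one bounds the adjoint on a real
function G.  The squared norms of the cosine and the sine adjoints add up to
    \int\int G(r) G(s) Re (1 / (z(r) + conj z(s))) dr ds,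
because the imaginary part of the kernel is antisymmetric and G is real
([kernel_adj_energy], [lap_gram]).  The remaining kernel is positive: it is
A(r, s) + A(s, r) with A(r, s) = x(r) / |z(r) + conj z(s)|^2.  Now
|z(r) + conj z(s)| satisfies a triangle inequality and dominates |r - s|, since
|z(r)| = r; hence A A^* <= C (A + A^* ) pointwise ([refl_kernel_composition]).
Pairing with g >= 0 gives |A^* g|^2 <= 2 C <g, A^* g>, which bounds A^* on L^2
and with it the quadratic form ([schur_symmetrized], [refl_energy_le]).

The case 1 < p < 2.  Since |T u| <= |u|_1, interpolation of Marcinkiewicz type
between this bound and the L^2 bound applies.  Here it is discretized over
dyadic levels of |T u|, so that only a truncated geometric sum is needed
([kernel_op_Lp]). *)

(** * Symmetrized Schur test *)
Section schur.
Local Open Scope ereal_scope.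
Context d (T : measurableType d) (R : realType).
Variable m : {sigma_finite_measure set T -> \bar R}.

Lemma ereal_amgm (C g : R) (x : \bar R) : (0 <= C)%R -> (0 <= g)%R -> 0 <= x ->
  (2 * C * g)%:E * x <= (2^-1)%:E * (x * x) + (2 * C ^+ 2 * g ^+ 2)%:E.
Proof.
move=> C0 g0; case: x => [x||]//=.
- rewrite -!EFinM -EFinD !lee_fin => x0.
  have := sqr_ge0 (x - 2 * C * g)%R; rewrite sqrrB => h.
  have : (0 <= x ^+ 2 - x * (2 * C * g) *+ 2 + (2 * C * g) ^+ 2)%R by [].
  nra.
- by move=> _; rewrite mulyy [X in _ <= X + _]gt0_muley ?lte_fin// addye// leey.
Qed.

(** With a = A^* g, the composition hypothesis gives |a|^2 <= C Q = 2 C <g, a>,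
where Q is the quadratic form on the left of the conclusion, and the right-hand
side is at most |a|^2 / 2 + 2 C^2 |g|^2.  The qualitative assumption that |a| is
finite allows the term |a|^2 / 2 to be absorbed; it does not enter the
constant. *)
Lemma schur_symmetrized (A : T * T -> R) (C : R) (g : T -> R) :
  measurable_fun [set: T * T] A -> (forall z, 0 <= A z)%R -> (0 < C)%R ->
  (forall r s, \int[m]_t (A (r, t) * A (s, t))%:E <=
     (C * (A (r, s) + A (s, r)))%:E) ->
  measurable_fun [set: T] g -> (forall r, 0 <= g r)%R ->
  \int[m]_t ((\int[m]_r (g r * A (r, t))%:E) * (\int[m]_r (g r * A (r, t))%:E))
    < +oo ->
  \int[m]_r \int[m]_s (g r * g s * (A (r, s) + A (s, r)))%:E <=
    (4 * C)%:E * \int[m]_r ((g r) ^+ 2)%:E.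
Proof.
move=> mA A0 C0 AA mg g0.
pose a : T -> \bar R := fun t => \int[m]_r (g r * A (r, t))%:E.
rewrite -/(a _) => afin.
have mfst := @measurable_fst _ _ T T.
have msnd := @measurable_snd _ _ T T.
have mgf : measurable_fun [set: T * T] (fun z : T * T => g z.1).
  exact: measurableT_comp.
have mgs : measurable_fun [set: T * T] (fun z : T * T => g z.2).
  exact: measurableT_comp.
have a0 t : 0 <= a t.
  by apply: integral_ge0 => r _; rewrite lee_fin mulr_ge0.
have ma : measurable_fun [set: T] a.
  apply: (measurable_fun_fubini_tonelli_G (fun z => (g z.1 * A z)%:E)).
    by apply/measurable_EFinP; exact: measurable_funM.
  by move=> z; rewrite lee_fin mulr_ge0.
have mas : measurable_fun [set: T * T] (fun z : T * T => a z.2).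
  exact: measurableT_comp.
have mAr r : measurable_fun [set: T] (fun t => A (r, t)).
  by apply: measurableT_comp => //; exact: measurable_pair1.
have mAl t : measurable_fun [set: T] (fun r => A (r, t)).
  by apply: measurableT_comp => //; exact: measurable_pair2.
pose I := \int[m]_t (a t * a t).
pose J := \int[m]_t ((g t)%:E * a t).
pose G := \int[m]_r ((g r) ^+ 2)%:E.
have I0 : 0 <= I by apply: integral_ge0 => t _; exact: mule_ge0.
have J0 : 0 <= J by apply: integral_ge0 => t _; rewrite mule_ge0// lee_fin.
have G0 : 0 <= G by apply: integral_ge0 => t _; rewrite lee_fin sqr_ge0.
set Q := (X in X <= _).
have QE : Q = J + J.
  have -> : Q = \int[m]_r ((g r)%:E * \int[m]_s (g s * A (r, s))%:E
                           + (g r)%:E * a r).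
    apply: eq_integral => r _.
    under eq_integral do rewrite -mulrA mulrDr EFinM EFinD.
    rewrite ge0_integralZl//; first last.
    - by rewrite lee_fin.
    - by move=> s _; rewrite adde_ge0// lee_fin mulr_ge0.
    - by apply: emeasurable_funD; apply/measurable_EFinP; exact: measurable_funM.
    rewrite ge0_integralD//.
    - by rewrite ge0_muleDr//;
        apply: integral_ge0 => s _; rewrite lee_fin mulr_ge0.
    - by move=> s _; rewrite lee_fin mulr_ge0.
    - by apply/measurable_EFinP; exact: measurable_funM.
    - by move=> s _; rewrite lee_fin mulr_ge0.
    - by apply/measurable_EFinP; exact: measurable_funM.
  have mF : measurable_fun [set: T] (fun r => \int[m]_s (g s * A (r, s))%:E).
    apply: (measurable_fun_fubini_tonelli_F (fun z => (g z.2 * A z)%:E)).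
      by apply/measurable_EFinP; exact: measurable_funM.
    by move=> z; rewrite lee_fin mulr_ge0.
  have F0 r : [set: T] r -> 0 <= (g r)%:E * \int[m]_s (g s * A (r, s))%:E.
    move=> _; rewrite mule_ge0// ?lee_fin//.
    by apply: integral_ge0 => s _; rewrite lee_fin mulr_ge0.
  have H0 r : [set: T] r -> 0 <= (g r)%:E * a r by move=> _; rewrite mule_ge0// lee_fin.
  have mgF : measurable_fun [set: T]
      (fun r => (g r)%:E * \int[m]_s (g s * A (r, s))%:E).
    by apply: emeasurable_funM => //; exact/measurable_EFinP.
  have mga : measurable_fun [set: T] (fun r => (g r)%:E * a r).
    by apply: emeasurable_funM => //; exact/measurable_EFinP.
  rewrite (ge0_integralD m measurableT F0 mgF H0 mga) -/J; congr (_ + J).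
  transitivity (\int[m]_r \int[m]_s (g r * (g s * A (r, s)))%:E).
    apply: eq_integral => r _.
    under [RHS]eq_integral do rewrite EFinM.
    rewrite ge0_integralZl// ?lee_fin//.
    - by apply/measurable_EFinP; exact: measurable_funM.
    - by move=> s _; rewrite lee_fin mulr_ge0.
  rewrite (fubini_tonelli (fun z => (g z.1 * (g z.2 * A z))%:E)); first last.
  - by move=> z; rewrite lee_fin !mulr_ge0.
  - by apply/measurable_EFinP; do 2 apply: measurable_funM => //.
  apply: eq_integral => s _ /=.
  under eq_integral do rewrite mulrCA EFinM.
  rewrite ge0_integralZl// ?lee_fin//.
  - by apply/measurable_EFinP; exact: measurable_funM.
  - by move=> r _; rewrite lee_fin mulr_ge0.
have mAt r : measurable_fun [set: T] (fun t => (A (r, t))%:E * a t).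
  by apply: emeasurable_funM => //; apply/measurable_EFinP.
(* |a|^2 is the integral of g(r) g(s) against the kernel A A^* at (r, s). *)
have IleQ : I <= C%:E * Q.
  have -> : I = \int[m]_r ((g r)%:E * \int[m]_t ((A (r, t))%:E * a t)).
    transitivity (\int[m]_t \int[m]_r ((g r * A (r, t))%:E * a t)).
      apply: eq_integral => t _; rewrite ge0_integralZr//.
      - by apply/measurable_EFinP; exact: measurable_funM.
      - by move=> r _; rewrite lee_fin mulr_ge0.
    rewrite -(fubini_tonelli (fun z => (g z.1 * A z)%:E * a z.2)); first last.
    - by move=> z; rewrite mule_ge0// lee_fin mulr_ge0.
    - apply: emeasurable_funM => //.
      by apply/measurable_EFinP; exact: measurable_funM.
    apply: eq_integral => r _ /=.
    under eq_integral do rewrite EFinM -muleA.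
    rewrite ge0_integralZl// ?lee_fin//.
    by move=> t _; rewrite mule_ge0// lee_fin.
  have mga : measurable_fun [set: T]
      (fun r => \int[m]_s (g r * g s * (A (r, s) + A (s, r)))%:E).
    apply: (measurable_fun_fubini_tonelli_F
      (fun z => (g z.1 * g z.2 * (A (z.1, z.2) + A (z.2, z.1)))%:E)).
      apply/measurable_EFinP; apply: measurable_funM; first exact: measurable_funM.
      apply: measurable_funD.
        by apply: (eq_measurable_fun A) => // -[].
      by apply: (measurableT_comp mA); exact: measurable_swap.
    by move=> z; rewrite lee_fin !mulr_ge0// addr_ge0.
  have Q0 r : [set: T] r ->
      0 <= \int[m]_s (g r * g s * (A (r, s) + A (s, r)))%:E.
    move=> _; apply: integral_ge0 => s _.
    by rewrite lee_fin !mulr_ge0// addr_ge0.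
  have C0' : 0 <= C%:E by rewrite lee_fin ltW.
  rewrite -(ge0_integralZl m measurableT mga Q0 C0').
  apply: (ge0_le_integral m measurableT).
  - move=> r _; apply: mule_ge0; first by rewrite lee_fin.
    by apply: integral_ge0 => t _; apply: mule_ge0 => //; rewrite lee_fin.
  - apply: emeasurable_funM => //; first exact/measurable_EFinP.
    apply: (measurable_fun_fubini_tonelli_F (fun z => (A z)%:E * a z.2)).
      by apply: emeasurable_funM => //; exact/measurable_EFinP.
    by move=> z; rewrite mule_ge0// lee_fin.
  - exact: measurable_funeM.
  move=> r _.
  have -> : \int[m]_t ((A (r, t))%:E * a t) =
      \int[m]_s ((g s)%:E * \int[m]_t (A (r, t) * A (s, t))%:E).
    transitivity (\int[m]_t \int[m]_s (g s * (A (r, t) * A (s, t)))%:E).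
      apply: eq_integral => t _; rewrite -ge0_integralZl//.
      - by apply: eq_integral => s _; rewrite -EFinM mulrCA.
      - by apply/measurable_EFinP; exact: measurable_funM.
      - by move=> s _; rewrite lee_fin mulr_ge0.
      - by rewrite lee_fin.
    rewrite -(fubini_tonelli (fun z => (g z.1 * (A (r, z.2) * A z))%:E)); first last.
    - by move=> z; rewrite lee_fin !mulr_ge0.
    - apply/measurable_EFinP; do 2 apply: measurable_funM => //.
      exact: (measurableT_comp (mAr r)).
    apply: eq_integral => s _ /=.
    under eq_integral do rewrite EFinM.
    rewrite ge0_integralZl// ?lee_fin//.
    - by apply/measurable_EFinP; exact: measurable_funM.
    - by move=> t _; rewrite lee_fin mulr_ge0.
  have mgA : measurable_fun [set: T] (fun s => (g s * (A (r, s) + A (s, r)))%:E).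
    apply/measurable_EFinP; apply: measurable_funM => //; exact: measurable_funD.
  have mAA : measurable_fun [set: T] (fun s => \int[m]_t (A (r, t) * A (s, t))%:E).
    apply: (measurable_fun_fubini_tonelli_F (fun z => (A (r, z.2) * A z)%:E)).
      apply/measurable_EFinP; apply: measurable_funM => //.
      exact: (measurableT_comp (mAr r)).
    by move=> z; rewrite lee_fin mulr_ge0.
  have -> : \int[m]_s (g r * g s * (A (r, s) + A (s, r)))%:E =
      (g r)%:E * \int[m]_s (g s * (A (r, s) + A (s, r)))%:E.
    under eq_integral do rewrite -mulrA EFinM.
    rewrite ge0_integralZl// ?lee_fin//.
    by move=> s _; rewrite lee_fin mulr_ge0// addr_ge0.
  rewrite muleCA; apply: lee_wpmul2l; first by rewrite lee_fin.
  have gA0 s : [set: T] s -> 0 <= (g s * (A (r, s) + A (s, r)))%:E.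
    by move=> _; rewrite lee_fin mulr_ge0// addr_ge0.
  rewrite -(ge0_integralZl m measurableT mgA gA0 C0').
  apply: (ge0_le_integral m measurableT).
  - move=> s _; apply: mule_ge0; first by rewrite lee_fin.
    by apply: integral_ge0 => t _; rewrite lee_fin mulr_ge0.
  - by apply: emeasurable_funM => //; exact/measurable_EFinP.
  - exact: measurable_funeM.
  move=> s _; rewrite [leRHS](_ : _ = (g s)%:E * (C * (A (r, s) + A (s, r)))%:E).
    by apply: lee_wpmul2l; rewrite ?lee_fin.
  by rewrite -!EFinM; congr EFin; ring.
have JleI : (2 * C)%:E * J <= (2^-1)%:E * I + (2 * C ^+ 2)%:E * G.
  rewrite -!ge0_integralZl//; first last.
  - by rewrite lee_fin mulr_ge0// ltW.
  - by move=> t _; rewrite mule_ge0// lee_fin.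
  - by apply: emeasurable_funM => //; exact/measurable_EFinP.
  - by move=> t _; rewrite mule_ge0// lee_fin.
  - exact: emeasurable_funM.
  - by rewrite lee_fin mulr_ge0// sqr_ge0.
  - by move=> t _; rewrite lee_fin sqr_ge0.
  - by apply/measurable_EFinP; exact: measurable_funX.
  have m1 : measurable_fun [set: T] (fun x => (2^-1)%:E * (a x * a x)).
    by apply: measurable_funeM; exact: emeasurable_funM.
  have m2 : measurable_fun [set: T] (fun x => (2 * C ^+ 2)%:E * (g x ^+ 2)%:E).
    by apply: measurable_funeM; apply/measurable_EFinP; exact: measurable_funX.
  have p1 t : [set: T] t -> 0 <= (2^-1)%:E * (a t * a t).
    by move=> _; apply: mule_ge0; [rewrite lee_fin | exact: mule_ge0].
  have p2 t : [set: T] t -> 0 <= (2 * C ^+ 2)%:E * (g t ^+ 2)%:E.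
    move=> _; rewrite -EFinM lee_fin; apply: mulr_ge0; last exact: sqr_ge0.
    by apply: mulr_ge0 => //; exact: sqr_ge0.
  rewrite -(ge0_integralD m measurableT p1 m1 p2 m2).
  apply: (ge0_le_integral m measurableT).
  - move=> t _; rewrite !mule_ge0// ?lee_fin ?mulr_ge0//; exact: ltW.
  - apply: measurable_funeM; apply: emeasurable_funM => //; exact/measurable_EFinP.
  - exact: emeasurable_funD.
  by move=> t _; rewrite muleA -!EFinM; apply: ereal_amgm => //; exact: ltW.
have [Goo|Goo] := eqVneq G +oo.
  by rewrite -/G Goo gt0_muley ?leey// lte_fin mulr_gt0.
rewrite -/G.
rewrite QE in IleQ *.
have Ifin : I \is a fin_num by rewrite ge0_fin_numE.
have Gfin : G \is a fin_num by rewrite ge0_fin_numE// ltey.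
have Jfin : J \is a fin_num.
  rewrite ge0_fin_numE// ltey; apply/eqP => Joo; move: JleI.
  rewrite Joo gt0_muley ?lte_fin ?mulr_gt0// leye_eq.
  by rewrite -(fineK Ifin) -(fineK Gfin).
move: IleQ JleI; rewrite -(fineK Ifin) -(fineK Jfin) -(fineK Gfin).
move: (fine I) (fine J) (fine G) => i j k.
rewrite -!(EFinM, EFinD) !lee_fin => h1 h2.
rewrite -(ler_pM2l C0); nra.
Qed.
End schur.

(** * The reflected kernel of a curve in the half-plane *)
Section cauchy.
Context {R : realType}.
Let mu := @lebesgue_measure R.

Lemma integral_cauchy_kernel (c r : R) : 0 < c ->
  (\int[mu]_t ((c ^+ 2 + (t - r) ^+ 2)^-1)%:E = (pi / c)%:E)%E.
Proof.
move=> c0; have cN0 : c != 0 by rewrite gt_eqF.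
pose F (x : R) := c * x + r.
have dF (x : R) : is_derive x 1 F c.
  have -> : F = c *: (@id R) + cst r by [].
  by apply: is_derive_eq; rewrite addr0 /GRing.scale/= mulr1.
have F'E : derive1 F = cst c.
  by apply/funext => x; rewrite derive1E; exact: derive_val.
rewrite (@increasing_ge0_integration_by_substitutionT _ F) //.
- rewrite [LHS](_ : _ = \int[mu]_x ((c^-1)%:E * (((oneDsqr x)^-1)%:E)))%E; last first.
    apply: eq_integral => x _; rewrite -EFinM; congr EFin.
    rewrite !fctE F'E /F /oneDsqr addrK /= exprMn.
    have h : 1 + x ^+ 2 != 0 by rewrite gt_eqF// ltr_wpDr// sqr_ge0.
    rewrite -{1}[c ^+ 2]mulr1 -mulrDr invfM expr2 invfM -!mulrA.
    by congr (_ * _); rewrite mulrC -mulrA mulfV// mulr1.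
  have m1 : measurable_fun [set: R] (fun x : R => ((oneDsqr x)^-1)%:E).
    apply/measurable_EFinP; apply: continuous_measurable_fun.
    exact: continuous_oneDsqrV.
  have p1 (x : R) : [set: R] x -> (0 <= ((oneDsqr x)^-1)%:E)%E.
    by move=> _; rewrite lee_fin invr_ge0 addr_ge0 ?sqr_ge0.
  have ci : 0 <= c^-1 by rewrite invr_ge0 ltW.
  rewrite (ge0_integralZl_EFin mu measurableT p1 m1 ci) ge0_symfun_integralT.
  + rewrite -set_itvcy integral0y_oneDsqr -!EFinM; congr EFin.
    by rewrite [RHS]mulrC; congr (_ * _); rewrite mulrC divfK.
  + by move=> x; rewrite invr_ge0 addr_ge0 ?sqr_ge0.
  + exact: continuous_oneDsqrV.
  + by move=> x; rewrite /oneDsqr /= sqrrN.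
- by move=> x y xy; rewrite /F ltrD2r ltr_pM2l.
- by rewrite F'E => x; exact: cst_continuous.
- by rewrite F'E; apply: is_cvg_cst.
- by rewrite F'E; apply: is_cvg_cst.

- apply/cvgrNyPle => A; near=> x; rewrite /F.
  have : x <= (A - r) / c by near: x; apply: nbhs_ninfty_le; exact: num_real.
  by rewrite ler_pdivlMr// mulrC => h; rewrite -lerBrDr.
- apply/cvgryPge => A; near=> x; rewrite /F.
  have : x >= (A - r) / c by near: x; apply: nbhs_pinfty_ge; exact: num_real.
  by rewrite ler_pdivrMr// mulrC => h; rewrite -lerBlDr.
- move=> x; apply: cvgV.
    by rewrite gt_eqF// ltr_wpDr ?sqr_ge0// exprn_gt0.
  apply: cvgD; first exact: cvg_cst.
  apply: (@continuous_comp _ _ _ (fun t => t - r) (fun t => t ^+ 2)).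
    by apply: cvgB; [exact: cvg_id|exact: cvg_cst].
  exact: exprn_continuous.
- by move=> x; rewrite invr_ge0 addr_ge0// sqr_ge0.
Unshelve. all: end_near. Qed.

End cauchy.

Section energy.
Context {R : realType}.
Let mu := @lebesgue_measure R.

(** Inversion is discontinuous at 0, but on nonnegative values it is a real power,
with the convention 0^-1 = 0 on both sides. *)
Lemma measurable_fun_inv_ge0 d (T : measurableType d) (f : T -> R) :
  measurable_fun [set: T] f -> (forall t, 0 <= f t) ->
  measurable_fun [set: T] (fun t => (f t)^-1).
Proof.
move=> mf f0; rewrite (_ : (fun t => _) = (fun t => f t `^ (-1))).
  by apply: (measurableT_comp (measurable_powR (-1))).
by apply/funext => t; rewrite powR_inv1.
Qed.

(** The square of |z(r) + conj z(s)| for z = x + i y: the distance from z(r) to the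
reflection of z(s) in the imaginary axis. *)
Definition refl_dist2 (x y : R -> R) (r s : R) : R :=
  (x r + x s) ^+ 2 + (y r - y s) ^+ 2.

Lemma refl_dist2C x y r s : refl_dist2 x y r s = refl_dist2 x y s r.
Proof. by rewrite /refl_dist2; ring. Qed.

Variables (x y : R -> R) (E : set R) (e : R).
Hypothesis mx : measurable_fun [set: R] x.
Hypothesis my : measurable_fun [set: R] y.
Hypothesis mE : measurable E.
Hypothesis muE : (mu E < +oo)%E.
Hypothesis e0 : 0 < e.
Hypothesis xe : forall r, E r -> e <= x r.
Hypothesis dist_ge : forall r s, E r -> E s -> (r - s) ^+ 2 <= refl_dist2 x y r s.

Let x0 r : E r -> 0 < x r. Proof. by move=> /xe; exact: lt_le_trans. Qed.

Lemma refl_dist2_gt0 r s : E r -> E s -> 0 < refl_dist2 x y r s.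
Proof.
by move=> /x0 xr /x0 xs; rewrite ltr_pwDl ?sqr_ge0// exprn_gt0// addr_gt0.
Qed.

(** The triangle inequality for the reflected distance holds because x >= 0: adding
2 x(t) to the real part of z(r) + conj z(s) can only increase it. *)
Lemma refl_dist2_triangle r s t : E r -> E s -> E t ->
  refl_dist2 x y r s <= 2 * (refl_dist2 x y r t + refl_dist2 x y s t).
Proof.
move=> /x0 xr /x0 xs /x0 xt; rewrite /refl_dist2.
move: (x r) (x s) (x t) (y r) (y s) (y t) xr xs xt => a b c k l m a0 b0 c0.
have h1 : (a + b) ^+ 2 <= 2 * ((a + c) ^+ 2 + (b + c) ^+ 2).
  have := sqr_ge0 (a - b); rewrite !expr2; nra.
have h2 : (k - l) ^+ 2 <= 2 * ((k - m) ^+ 2 + (l - m) ^+ 2).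
  have := sqr_ge0 (k + l - 2 * m); rewrite !expr2; nra.
by rewrite !mulrDr in h1 h2 *; lra.
Qed.

Lemma refl_dist2_ge r s : E r -> E s ->
  x r ^+ 2 + (s - r) ^+ 2 <= 2 * refl_dist2 x y r s.
Proof.
move=> Er Es; have := dist_ge Er Es; have := x0 Er; have := x0 Es.
rewrite -(sqrrN (r - s)) opprB mulr_natl mulr2n => xs xr h.
apply: lerD => //; rewrite -[leLHS]addr0 lerD ?sqr_ge0//.
by rewrite ler_sqr ?nnegrE ?addr_ge0 ?ltW// ltr_pwDr.
Qed.

(** The indicators make the kernel bounded, with support in a set of finite measure,
which supplies the finiteness hypothesis of the symmetrized Schur test. *)
Definition refl_kernel (z : R * R) : R :=
  \1_E z.1 * \1_E z.2 * (x z.1 / refl_dist2 x y z.1 z.2).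

Lemma refl_kernelE r s : E r -> E s ->
  refl_kernel (r, s) = x r / refl_dist2 x y r s.
Proof. by move=> Er Es; rewrite /refl_kernel/= !indicE !mem_set// !mul1r. Qed.

Lemma refl_kernel_out r s : ~ (E r /\ E s) -> refl_kernel (r, s) = 0.
Proof.
move=> ErEs; rewrite /refl_kernel/= !indicE.
have [Er|Er] := pselect (E r); last by rewrite memNset// !mul0r.
rewrite [s \in E]memNset ?mulr0 ?mul0r// => Es; exact: ErEs.
Qed.

Lemma refl_kernel_ge0 z : 0 <= refl_kernel z.
Proof.
case: z => r s; have [[Er Es]|h] := pselect (E r /\ E s).
  by rewrite refl_kernelE// divr_ge0 ?ltW// ?x0// refl_dist2_gt0.
by rewrite refl_kernel_out.
Qed.

Lemma measurable_refl_kernel : measurable_fun [set: R * R] refl_kernel.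
Proof.
have mfst := @measurable_fst _ _ (measurableTypeR R) (measurableTypeR R).
have msnd := @measurable_snd _ _ (measurableTypeR R) (measurableTypeR R).
have m1 (h : R -> R) : measurable_fun [set: R] h ->
    measurable_fun [set: R * R] (fun z : R * R => h z.1).
  by move=> mh; exact: (measurableT_comp mh mfst).
have m2 (h : R -> R) : measurable_fun [set: R] h ->
    measurable_fun [set: R * R] (fun z : R * R => h z.2).
  by move=> mh; exact: (measurableT_comp mh msnd).
apply: measurable_funM.
  by apply: measurable_funM; [apply: m1|apply: m2]; exact: measurable_indic.
apply: measurable_funM; first exact: m1.
apply: measurable_fun_inv_ge0; last by move=> z; rewrite addr_ge0// sqr_ge0.
apply: measurable_funD; apply: measurable_funX.
  by apply: measurable_funD; [exact: m1|exact: m2].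
by apply: measurable_funB; [exact: m1|exact: m2].
Qed.

(** One of |z(r) + conj z(t)| and |z(s) + conj z(t)| is at least half of
|z(r) + conj z(s)|, so the product of the two kernels is controlled by
x(r) x(s) / |z(r) + conj z(s)|^2 times a sum of two Cauchy kernels in t, of
integrals pi / x(r) and pi / x(s). *)
Lemma refl_kernel_composition r s :
  (\int[mu]_t (refl_kernel (r, t) * refl_kernel (s, t))%:E <=
   (4 * pi * (refl_kernel (r, s) + refl_kernel (s, r)))%:E)%E.
Proof.
have mk u : measurable_fun [set: R] (fun t => refl_kernel (u, t)).
  apply: (measurableT_comp measurable_refl_kernel).
  exact: measurable_pair1.
have [[Er Es]|h] := pselect (E r /\ E s); last first.
  rewrite integral0_eq => [|t _].
    rewrite lee_fin mulr_ge0 ?mulr_ge0 ?pi_ge0//.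
    by rewrite addr_ge0 ?refl_kernel_ge0.
  have [Er|Er] := pselect (E r); last by rewrite refl_kernel_out ?mul0r// => -[].
  by rewrite (@refl_kernel_out s) ?mulr0// => -[Es _]; exact: h.
pose q u (t : R) := (x u ^+ 2 + (t - u) ^+ 2)^-1.
pose D := refl_dist2 x y r s.
have D0 : 0 < D by exact: refl_dist2_gt0.
have q0 u t : 0 <= q u t by rewrite invr_ge0 addr_ge0 ?sqr_ge0.
have mq u : measurable_fun [set: R] (q u).
  apply: measurable_fun_inv_ge0; last by move=> t; rewrite addr_ge0// sqr_ge0.
  apply: measurable_funD => //.
  by apply: measurable_funX; apply: measurable_funB.
have bound t : refl_kernel (r, t) * refl_kernel (s, t) <=
    (4 * x r * x s / D) * (q r t + q s t).
  have [Et|Et] := pselect (E t); last first.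
    rewrite refl_kernel_out ?mul0r; last by case.
    by rewrite mulr_ge0 ?addr_ge0// divr_ge0 ?mulr_ge0// ltW// x0.
  rewrite !refl_kernelE//.
  have d1 := refl_dist2_gt0 Er Et; have d2 := refl_dist2_gt0 Es Et.
  have := refl_dist2_triangle Er Es Et; rewrite -/D.
  have qE u : E u -> (refl_dist2 x y u t)^-1 <= 2 * q u t.
    move=> Eu; have := refl_dist2_ge Eu Et.
    have qp : 0 < x u ^+ 2 + (t - u) ^+ 2.
      by rewrite ltr_pwDl ?sqr_ge0// exprn_gt0// x0.
    rewrite /q ler_pdivlMr//.
    by rewrite [_^-1 * _]mulrC ler_pdivrMr// refl_dist2_gt0.
  have := qE r Er; have := qE s Es.
  move: d1 d2; set d1 := refl_dist2 x y r t; set d2 := refl_dist2 x y s t.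
  move=> d10 d20 hs hr tri.
  have -> : x r / d1 * (x s / d2) = x r * x s * (d1^-1 * d2^-1) by ring.
  have -> : 4 * x r * x s / D * (q r t + q s t) =
     x r * x s * (4 / D * (q r t + q s t)) by ring.
  apply: ler_wpM2l; first by rewrite mulr_ge0// ltW// x0.
  have step : d1^-1 * d2^-1 <= 2 / D * (d1^-1 + d2^-1).
    have -> : d1^-1 + d2^-1 = (d1 + d2) * (d1^-1 * d2^-1).
      by field; rewrite !gt_eqF.
    rewrite mulrA ler_peMl//.
      by rewrite mulr_ge0// invr_ge0 ltW.
    by rewrite mulrAC ler_pdivlMr// mul1r.
  apply: (le_trans step); have -> : 4 / D * (q r t + q s t) =
     2 / D * (2 * q r t + 2 * q s t) by ring.
  by apply: ler_wpM2l; [rewrite divr_ge0// ltW | exact: lerD].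
have mb : measurable_fun [set: R]
   (fun t => ((4 * x r * x s / D) * (q r t + q s t))%:E).
  apply/measurable_EFinP; apply: measurable_funM => //.
  exact: measurable_funD.
apply: (@le_trans _ _ (\int[mu]_t ((4 * x r * x s / D) * (q r t + q s t))%:E)%E).
  apply: (ge0_le_integral mu measurableT) => //.
  - by move=> t _; rewrite lee_fin mulr_ge0 ?refl_kernel_ge0.
  - by apply/measurable_EFinP; apply: measurable_funM; exact: mk.
  - by move=> t _; rewrite lee_fin.
under eq_integral do rewrite EFinM EFinD.
have c0 : 0 <= 4 * x r * x s / D by rewrite divr_ge0 ?mulr_ge0// ltW// x0.
have mqE u : measurable_fun [set: R] (fun t => (q u t)%:E) by exact/measurable_EFinP.
have q0E u t : [set: R] t -> (0 <= (q u t)%:E)%E by rewrite lee_fin.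
rewrite (ge0_integralZl_EFin mu measurableT _ _ c0).
- rewrite (ge0_integralD mu measurableT (q0E r) (mqE r) (q0E s) (mqE s)).
  rewrite !integral_cauchy_kernel ?x0// -EFinD -EFinM lee_fin.
  rewrite !refl_kernelE// (refl_dist2C x y s r) -/D le_eqVlt; apply/orP; left.
  by apply/eqP; field; rewrite !gt_eqF ?x0.
- by move=> t _; apply: adde_ge0; exact: q0E.
- by apply: emeasurable_funD; exact: mqE.
Qed.

(** The hypothesis [dist_ge] holds for a curve that is parametrized by its modulus,
|z(r)| = r.  The bound M on g is qualitative: it supplies the finiteness that the
symmetrized Schur test asks for, and it does not enter the constant. *)
Lemma refl_energy_le (g : R -> R) (M : R) : measurable_fun [set: R] g ->
  (forall r, 0 <= g r <= M) ->
  (\int[mu]_r \int[mu]_s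
     (g r * g s * (refl_kernel (r, s) + refl_kernel (s, r)))%:E <=
   (16 * pi)%:E * \int[mu]_r ((g r) ^+ 2)%:E)%E.
Proof.
move=> mg g0M.
have g0 r : 0 <= g r by case/andP: (g0M r).
have gM r : g r <= M by case/andP: (g0M r).
have M0 : 0 <= M by exact: le_trans (g0 0) (gM 0).
have -> : 16 * pi = 4 * (4 * pi) :> R by ring.
apply: schur_symmetrized => //.
- exact: measurable_refl_kernel.
- exact: refl_kernel_ge0.
- by rewrite mulr_gt0// pi_gt0.
- exact: refl_kernel_composition.
have muEfin : mu E \is a fin_num by rewrite ge0_fin_numE.
have kle r t : refl_kernel (r, t) <= e^-1 * \1_E r * \1_E t.
  have [[Er Et]|h] := pselect (E r /\ E t); last first.
    by rewrite refl_kernel_out// !mulr_ge0// invr_ge0 ltW.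
  rewrite refl_kernelE// !indicE !mem_set// !mulr1.
  rewrite ler_pdivrMr ?refl_dist2_gt0// mulrC ler_pdivlMr//.
  have := xe Er; have := x0 Er; have := x0 Et; rewrite /refl_dist2.
  have := sqr_ge0 (y r - y t); rewrite !expr2; nra.
have mk t : measurable_fun [set: R] (fun r => refl_kernel (r, t)).
  apply: (measurableT_comp measurable_refl_kernel).
  exact: measurable_pair2.
have ale t : (\int[mu]_r (g r * refl_kernel (r, t))%:E <=
    (M * e^-1 * fine (mu E) * \1_E t)%:E)%E.
  apply: (@le_trans _ _ (\int[mu]_r ((M * e^-1 * \1_E t)%:E * (\1_E r)%:E))%E).
    apply: (ge0_le_integral mu measurableT).
    - by move=> r _; rewrite lee_fin mulr_ge0// refl_kernel_ge0.
    - by apply/measurable_EFinP; apply: measurable_funM => //; exact: mk.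
    - by apply: measurable_funeM; apply/measurable_EFinP; exact: measurable_indic.
    move=> r _; rewrite -EFinM lee_fin.
    have -> : M * e^-1 * \1_E t * \1_E r = M * (e^-1 * \1_E r * \1_E t) by ring.
    by apply: ler_pM; [exact: g0|exact: refl_kernel_ge0|exact: gM|exact: kle].
  rewrite ge0_integralZl_EFin//.
  - rewrite integral_indic// setIT -[X in (_ * X <= _)%E](fineK muEfin) -EFinM.
    by rewrite lee_fin mulrAC.
  - by apply/measurable_EFinP; exact: measurable_indic.
  - by rewrite !mulr_ge0// invr_ge0 ltW.
pose c := M * e^-1 * fine (mu E).
have c0 : 0 <= c by rewrite !mulr_ge0 ?fine_ge0// invr_ge0 ltW.
apply: (@le_lt_trans _ _ (\int[mu]_t ((c ^+ 2)%:E * (\1_E t)%:E))%E).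
  have a0 t : (0 <= \int[mu]_r (g r * refl_kernel (r, t))%:E)%E.
    by apply: integral_ge0 => r _; rewrite lee_fin mulr_ge0// refl_kernel_ge0.
  have ma : measurable_fun [set: R]
      (fun t => \int[mu]_r (g r * refl_kernel (r, t))%:E)%E.
    apply: (@measurable_fun_fubini_tonelli_G _ _ (measurableTypeR R)
      (measurableTypeR R) R mu (fun z => (g z.1 * refl_kernel z)%:E)).
      apply/measurable_EFinP; apply: measurable_funM.
        exact: (measurableT_comp mg
          (@measurable_fst _ _ (measurableTypeR R) (measurableTypeR R))).
      exact: measurable_refl_kernel.
    by move=> z; rewrite lee_fin mulr_ge0// refl_kernel_ge0.
  apply: (ge0_le_integral mu measurableT).
  - by move=> t _; exact: mule_ge0.
  - exact: emeasurable_funM.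
  - by apply: measurable_funeM; apply/measurable_EFinP; exact: measurable_indic.
  move=> t _; have -> : ((c ^+ 2)%:E * (\1_E t)%:E = (c * \1_E t)%:E * (c * \1_E t)%:E)%E.
    rewrite -!EFinM; congr EFin; by rewrite indicE; case: (t \in E); rewrite ?mulr1 ?mulr0 ?expr2.
  exact: lee_pmul.
rewrite ge0_integralZl_EFin//.
- by rewrite integral_indic// setIT -[X in (_ * X < _)%E](fineK muEfin) -EFinM ltry.
- by apply/measurable_EFinP; exact: measurable_indic.
- exact: sqr_ge0.
Qed.
End energy.

(** * Integral operators and their adjoints *)

Lemma measurable_Rintegral_section d1 d2 (T1 : measurableType d1)
    (T2 : measurableType d2) (R : realType)
    (m2 : {sigma_finite_measure set T2 -> \bar R}) (F : T1 * T2 -> R) :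
  measurable_fun [set: T1 * T2] F ->
  measurable_fun [set: T1] (fun r => \int[m2]_t F (r, t)).
Proof.
move=> mF; apply: measurableT_comp => //.
have mFE : measurable_fun [set: T1 * T2] (EFin \o F) by exact/measurable_EFinP.
rewrite (_ : (fun r => _) = (fun r => fubini_F m2 (EFin \o F)^\+ r -
    fubini_F m2 (EFin \o F)^\- r)%E); last first.
  apply/funext => r; rewrite integralE /fubini_F.
  by congr (_ - _)%E; apply: eq_integral => t _; rewrite ?funeposE ?funenegE.
apply: emeasurable_funB; apply: measurable_fun_fubini_tonelli_F => //.
  exact: measurable_funepos.
exact: measurable_funeneg.
Qed.

Section fubini_dominated.
Context d1 d2 (T1 : measurableType d1) (T2 : measurableType d2) (R : realType).
Variables (m1 : {sigma_finite_measure set T1 -> \bar R})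
          (m2 : {sigma_finite_measure set T2 -> \bar R}).
Variables (F : T1 * T2 -> R) (phi : T1 -> R) (psi : T2 -> R).
Hypothesis mF : measurable_fun [set: T1 * T2] F.
Hypothesis iphi : m1.-integrable [set: T1] (EFin \o phi).
Hypothesis ipsi : m2.-integrable [set: T2] (EFin \o psi).
Hypothesis Fle : forall z, `|F z| <= phi z.1 * psi z.2.

Lemma dominated_integrable1 r : m2.-integrable [set: T2] (fun t => (F (r, t))%:E).
Proof.
have h := integrableZl measurableT (phi r) ipsi.
apply: (le_integrable measurableT _ _ h).
  by apply/measurable_EFinP; apply: measurable_fun_pair2.
by move=> t _; rewrite /= lee_fin (le_trans (Fle (r, t)))//= ler_norm.
Qed.

Lemma dominated_integrable2 t : m1.-integrable [set: T1] (fun r => (F (r, t))%:E).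
Proof.
have h := integrableZl measurableT (psi t) iphi.
apply: (le_integrable measurableT _ _ h).
  by apply/measurable_EFinP; apply: measurable_fun_pair1.
by move=> r _; rewrite /= lee_fin (le_trans (Fle (r, t)))//= mulrC ler_norm.
Qed.

Lemma dominated_integrable : (m1 \x m2)%E.-integrable [set: T1 * T2] (EFin \o F).
Proof.
have mphi : measurable_fun [set: T1] phi.
  by apply/measurable_EFinP; case/integrableP : iphi.
have mpsi : measurable_fun [set: T2] psi.
  by apply/measurable_EFinP; case/integrableP : ipsi.
apply/integrable12ltyP; first exact/measurable_EFinP.
apply: (@le_lt_trans _ _ (\int[m1]_r (`|phi r|%:E * \int[m2]_t `|psi t|%:E))%E).
  apply: (ge0_le_integral m1 measurableT).
  - by move=> r _; apply: integral_ge0.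
  - apply: (measurable_fun_fubini_tonelli_F (fun z => `|(EFin \o F) z|%E)) => //.
    by apply: measurableT_comp => //; exact/measurable_EFinP.
  - under eq_fun do rewrite muleC.
    apply: measurable_funeM; apply/measurable_EFinP.
    exact: measurableT_comp.
  move=> r _; rewrite -ge0_integralZl//; last first.
    by apply/measurable_EFinP; exact: measurableT_comp.
  apply: (ge0_le_integral m2 measurableT) => //.
  - apply: measurableT_comp => //; apply/measurable_EFinP.
    exact: measurable_fun_pair2.
  - apply: measurable_funeM; apply/measurable_EFinP; exact: measurableT_comp.
  move=> t _; rewrite /= -EFinM lee_fin (le_trans (Fle (r, t)))//=.
  by rewrite -normrM ler_norm.
rewrite ge0_integralZr//; last 2 first.
- by apply/measurable_EFinP; exact: measurableT_comp.
- exact: integral_ge0.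
apply: lte_mul_pinfty.
- exact: integral_ge0.
- rewrite ge0_fin_numE; last exact: integral_ge0.
  by case/integrableP : iphi.
- by case/integrableP : ipsi.
Qed.

Lemma measurable_dominated2 :
  measurable_fun [set: T2] (fun t => \int[m1]_r F (r, t)).
Proof.
by apply: measurableT_comp => //; apply: (measurable_fubini_G dominated_integrable).
Qed.

Lemma dominated_Fubini :
  \int[m1]_r \int[m2]_t F (r, t) = \int[m2]_t \int[m1]_r F (r, t).
Proof.
rewrite /Rintegral; congr fine.
transitivity (\int[m1]_r \int[m2]_t (F (r, t))%:E)%E.
  apply: eq_integral => r _; rewrite fineK//.
  exact/integrable_fin_num/dominated_integrable1.
rewrite (Fubini dominated_integrable).
apply: eq_integral => t _; rewrite fineK//.
exact/integrable_fin_num/dominated_integrable2.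
Qed.

Lemma dominated_integrable_Fubini1 :
  m1.-integrable [set: T1] (EFin \o (fun r => \int[m2]_t F (r, t))).
Proof.
apply: eq_integrable (integrable_fubini_F dominated_integrable) => // r _ /=.
by rewrite /fubini_F /= fineK//; exact/integrable_fin_num/dominated_integrable1.
Qed.

End fubini_dominated.

(** The majorant w of the kernel serves both for integrability and, through w <= 1,
for the trivial estimate from L^1 to L^oo. *)
Section adjoint.
Context d1 d2 (T1 : measurableType d1) (T2 : measurableType d2) (R : realType).
Variables (m1 : {sigma_finite_measure set T1 -> \bar R})
          (m2 : {sigma_finite_measure set T2 -> \bar R}).
Variables (k : T1 * T2 -> R) (w : T2 -> R).
Hypothesis mk : measurable_fun [set: T1 * T2] k.
Hypothesis iw : m2.-integrable [set: T2] (EFin \o w).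
Hypothesis w01 : forall t, 0 <= w t <= 1.
Hypothesis kw : forall z, `|k z| <= w z.2.

Definition kernel_op (u : T2 -> R) (r : T1) : R := \int[m2]_t (u t * k (r, t)).
Definition kernel_adj (G : T1 -> R) (t : T2) : R := \int[m1]_r (G r * k (r, t)).

Definition kernel_gram (z : T1 * T1) : R :=
  \int[m2]_t (k (z.1, t) * k (z.2, t)).

Let k1 z : `|k z| <= 1.
Proof. by apply: le_trans (kw z) _; case/andP: (w01 z.2). Qed.

Section adj.
Variable G : T1 -> R.
Hypothesis iG : m1.-integrable [set: T1] (EFin \o G).

Let mG : measurable_fun [set: T1] G.
Proof. by apply/measurable_EFinP; case/integrableP : iG. Qed.

Let iGn : m1.-integrable [set: T1] (EFin \o (fun r => `|G r|)).
Proof. exact: integrable_norm. Qed.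

Let mGk : measurable_fun [set: T1 * T2] (fun z => G z.1 * k z).
Proof.
by apply: measurable_funM => //; exact: (measurableT_comp mG (@measurable_fst _ _ T1 T2)).
Qed.

Let Gkle z : `|G z.1 * k z| <= `|G z.1| * w z.2.
Proof. by rewrite normrM ler_wpM2l. Qed.

Lemma measurable_kernel_adj : measurable_fun [set: T2] (kernel_adj G).
Proof. exact: (measurable_dominated2 mGk iGn iw Gkle). Qed.

Lemma kernel_adj_le t : `|kernel_adj G t| <= (\int[m1]_r `|G r|) * w t.
Proof.
rewrite /kernel_adj -RintegralZr//.
apply: le_trans.
  apply: le_normr_Rintegral => //.
  exact: (dominated_integrable2 mGk iGn Gkle t).
apply: le_Rintegral => //.
- exact: (integrable_norm (dominated_integrable2 mGk iGn Gkle t)).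
- exact: (integrableZr _ _ iGn).
- by move=> r _; exact: (Gkle (r, t)).
Qed.

Lemma integrable_sqr_kernel_adj :
  m2.-integrable [set: T2] (EFin \o (fun t => kernel_adj G t ^+ 2)).
Proof.
pose c := \int[m1]_r `|G r|.
have h := integrableZl measurableT (c ^+ 2) iw.
apply: (le_integrable measurableT _ _ h).
  by apply/measurable_EFinP; apply: measurable_funX; exact: measurable_kernel_adj.
move=> t _; rewrite /= lee_fin normrX.
have [w0 w1] := andP (w01 t).
have cw0 : 0 <= c ^+ 2 * w t by apply: mulr_ge0 => //; exact: sqr_ge0.
rewrite [leRHS]ger0_norm//.
apply: (@le_trans _ _ ((c * w t) ^+ 2)).
  by rewrite ler_sqr ?nnegrE ?kernel_adj_le// mulr_ge0// /c Rintegral_ge0.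
by rewrite exprMn; apply: ler_wpM2l; [exact: sqr_ge0 | rewrite expr2; nra].
Qed.

Lemma kernel_adj_energy :
  \int[m2]_t (kernel_adj G t ^+ 2) =
  \int[m1]_r \int[m1]_s (G r * G s * kernel_gram (r, s)).
Proof.
pose c := \int[m1]_r `|G r|.
have c0 : 0 <= c by apply: Rintegral_ge0.
have iGk t : m1.-integrable [set: T1] (EFin \o (fun r => G r * k (r, t))).
  exact: (dominated_integrable2 mGk iGn Gkle t).
have w0 t : 0 <= w t by case/andP: (w01 t).
have mk1 r : measurable_fun [set: T2] (fun t => k (r, t)).
  exact: measurable_fun_pair2.
transitivity (\int[m2]_t \int[m1]_r (G r * k (r, t) * kernel_adj G t)).
  by apply: eq_Rintegral => t _; rewrite RintegralZr// expr2.
rewrite -(@dominated_Fubini _ _ _ _ _ m1 m2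
  (fun z => G z.1 * k z * kernel_adj G z.2) (fun r => `|G r|) (fun t => c * w t)) //=.
- apply: eq_Rintegral => r _.
  have iksG s : m2.-integrable [set: T2] (EFin \o (fun t => k (r, t) * k (s, t))).
    apply: (le_integrable measurableT _ _ iw).
      by apply/measurable_EFinP; exact: measurable_funM.
    move=> t _; rewrite /= lee_fin normrM (ger0_norm (w0 t)) -[leRHS]mulr1.
    by apply: ler_pM => //; exact: (kw (r, t)).
  transitivity (\int[m2]_t \int[m1]_s (G r * G s * (k (r, t) * k (s, t)))).
    apply: eq_Rintegral => t _; rewrite /kernel_adj -RintegralZl//.
    by apply: eq_Rintegral => s _; ring.
  rewrite -(@dominated_Fubini _ _ _ _ _ m1 m2
     (fun z => G r * G z.1 * (k (r, z.2) * k z)) (fun s => `|G r| * `|G s|) w) //=.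
  + by apply: eq_Rintegral => s _; rewrite RintegralZl.
  + apply: measurable_funM.
      by apply: measurable_funM => //; exact: (measurableT_comp mG (@measurable_fst _ _ T1 T2)).
    apply: measurable_funM => //.
    exact: (measurableT_comp (mk1 r) (@measurable_snd _ _ T1 T2)).
  + exact: (integrableZl measurableT _ iGn).
  + move=> z; rewrite !normrM ler_wpM2l ?mulr_ge0// -[leRHS]mulr1.
    by apply: ler_pM => //; exact: (kw (r, z.2)).
- apply: measurable_funM => //.
  exact: (measurableT_comp measurable_kernel_adj (@measurable_snd _ _ T1 T2)).
- exact: (integrableZl measurableT _ iw).
- move=> z; rewrite !normrM -mulrA ler_wpM2l// -[leRHS]mul1r.
  apply: ler_pM => //; exact: kernel_adj_le.
Qed.

End adj.

Section op.
Variable u : T2 -> R.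
Hypothesis meas_u : measurable_fun [set: T2] u.
Hypothesis iuw : m2.-integrable [set: T2] (EFin \o (fun t => `|u t| * w t)).

Let muk : measurable_fun [set: T1 * T2] (fun z => u z.2 * k z).
Proof.
by apply: measurable_funM => //; exact: (measurableT_comp meas_u (@measurable_snd _ _ T1 T2)).
Qed.

Lemma integrable_kernel_op r :
  m2.-integrable [set: T2] (EFin \o (fun t => u t * k (r, t))).
Proof.
apply: (le_integrable measurableT _ _ iuw).
  by apply/measurable_EFinP; exact: (measurable_fun_pair2 _ muk).
move=> t _; rewrite /= lee_fin normrM; apply: le_trans (ler_norm _).
by rewrite ler_wpM2l//; exact: (kw (r, t)).
Qed.

Lemma kernel_op_pairing (G : T1 -> R) : m1.-integrable [set: T1] (EFin \o G) ->
  \int[m1]_r (G r * kernel_op u r) = \int[m2]_t (u t * kernel_adj G t).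
Proof.
move=> iG.
have mG : measurable_fun [set: T1] G.
  by apply/measurable_EFinP; case/integrableP : iG.
transitivity (\int[m1]_r \int[m2]_t (G r * (u t * k (r, t)))).
  by apply: eq_Rintegral => r _; rewrite RintegralZl//; exact: integrable_kernel_op.
rewrite (@dominated_Fubini _ _ _ _ _ m1 m2 (fun z => G z.1 * (u z.2 * k z))
  (fun r => `|G r|) (fun t => `|u t| * w t)) //=.
- apply: eq_Rintegral => t _; rewrite -RintegralZl//.
    by apply: eq_Rintegral => r _; rewrite mulrCA.
  apply: (@dominated_integrable2 _ _ _ _ _ m1 (fun z => G z.1 * k z)
    (fun r => `|G r|) w) => //.
  + by apply: measurable_funM => //; exact: (measurableT_comp mG (@measurable_fst _ _ T1 T2)).
  + exact: integrable_norm.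
  + by move=> z; rewrite normrM ler_wpM2l.
- by apply: measurable_funM => //; exact: (measurableT_comp mG (@measurable_fst _ _ T1 T2)).
- exact: integrable_norm.
- by move=> z; rewrite !normrM ler_wpM2l// ler_wpM2l.
Qed.

Variable v : T1 -> R.
Hypothesis iv : m1.-integrable [set: T1] (EFin \o v).
Hypothesis v01 : forall r, 0 <= v r <= 1.
Hypothesis kvw : forall z, `|k z| <= v z.1 * w z.2.

Lemma measurable_kernel_op : measurable_fun [set: T1] (kernel_op u).
Proof. exact: (measurable_Rintegral_section m2 muk). Qed.

Lemma kernel_op_le_supp r : `|kernel_op u r| <= (\int[m2]_t (`|u t| * w t)) * v r.
Proof.
rewrite mulrC -RintegralZl//.
apply: le_trans (le_normr_Rintegral _ (integrable_kernel_op r)) _ => //.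
apply: le_Rintegral => //; first exact: integrable_norm (integrable_kernel_op r).
  exact: (integrableZl measurableT _ iuw).
by move=> t _; rewrite normrM mulrCA ler_wpM2l//; exact: (kvw (r, t)).
Qed.

Lemma integrable_sqr_supp (G : T1 -> R) (M : R) : measurable_fun [set: T1] G ->
  (forall r, `|G r| <= M * v r) ->
  m1.-integrable [set: T1] (EFin \o (fun r => G r ^+ 2)).
Proof.
move=> mG GM; have h := integrableZl measurableT (M ^+ 2) iv.
apply: (le_integrable measurableT _ _ h).
  by apply/measurable_EFinP; exact: measurable_funX.
move=> r _; rewrite /= lee_fin normrX.
have [v0 v1] := andP (v01 r).
apply: (@le_trans _ _ ((M * v r) ^+ 2)).
  by rewrite ler_sqr ?nnegrE// (le_trans _ (GM r)).
apply: le_trans (ler_norm _); rewrite exprMn ler_wpM2l ?sqr_ge0//.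
by rewrite expr2; nra.
Qed.

(** T T^* duality: with G = T u, the square |G|^2 equals the pairing of u with the
adjoint of G, which is at most K |u|^2 / 2 + |T^* G|^2 / (2 K), hence at most
K |u|^2 / 2 + |G|^2 / 2.  The majorant v makes |G|^2 finite, so that it can be
absorbed; the hypothesis on adjoints is only asked for functions dominated by a
multiple of v. *)
Lemma kernel_op_L2 (K : R) : 0 < K ->
  (forall (G : T1 -> R) (M : R), measurable_fun [set: T1] G ->
     (forall r, `|G r| <= M * v r) ->
     \int[m2]_t (kernel_adj G t ^+ 2) <= K * \int[m1]_r (G r ^+ 2)) ->
  m2.-integrable [set: T2] (EFin \o (fun t => u t ^+ 2)) ->
  \int[m1]_r (kernel_op u r ^+ 2) <= K * \int[m2]_t (u t ^+ 2).
Proof.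
move=> K0 adjK iu2.
have mT := measurable_kernel_op.
pose B := \int[m2]_t (`|u t| * w t).
have TB := kernel_op_le_supp.
have iT2 := integrable_sqr_supp mT TB.
have iT : m1.-integrable [set: T1] (EFin \o (kernel_op u)).
  have h := integrableZl measurableT B iv.
  apply: (le_integrable measurableT _ _ h); first exact/measurable_EFinP.
  by move=> r _; rewrite /= lee_fin (le_trans (TB r))// ler_norm.
have HH := adjK _ _ mT TB.
set X := \int[m1]_r (kernel_op u r ^+ 2) in HH *.
set U := \int[m2]_t (u t ^+ 2).
have XE : X = \int[m2]_t (u t * kernel_adj (kernel_op u) t).
  by rewrite -kernel_op_pairing//; apply: eq_Rintegral => r _; rewrite expr2.
have iH2 := integrable_sqr_kernel_adj iT.
have iS : m2.-integrable [set: T2] (EFin \o (fun t => K / 2 * u t ^+ 2 +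
    (2 * K)^-1 * kernel_adj (kernel_op u) t ^+ 2)).
  exact: (integrableD measurableT (integrableZl measurableT (K / 2) iu2)
    (integrableZl measurableT (2 * K)^-1 iH2)).
have amgm (a b : R) : `|a * b| <= K / 2 * a ^+ 2 + (2 * K)^-1 * b ^+ 2.
  rewrite normrM -(real_normK (num_real a)) -(real_normK (num_real b)).
  rewrite -subr_ge0 (_ : _ - _ = (2 * K)^-1 * (K * `|a| - `|b|) ^+ 2).
    by rewrite mulr_ge0 ?sqr_ge0// invr_ge0 mulr_ge0// ltW.
  by field; rewrite gt_eqF.
have iuH : m2.-integrable [set: T2]
    (EFin \o (fun t => u t * kernel_adj (kernel_op u) t)).
  apply: (le_integrable measurableT _ _ iS).
    apply/measurable_EFinP; apply: measurable_funM => //.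
    exact: measurable_kernel_adj.
  by move=> t _; rewrite /= lee_fin (le_trans _ (ler_norm _)).
have : X <= K / 2 * U + (2 * K)^-1 * (K * X).
  rewrite {1}XE; apply: le_trans (le_Rintegral _ iuH iS _) _ => //.
    by move=> t _; apply: le_trans (ler_norm _) _.
  rewrite RintegralD//; last 2 first.
  - exact: (integrableZl measurableT (K / 2) iu2).
  - exact: (integrableZl measurableT (2 * K)^-1 iH2).
  rewrite !RintegralZl// lerD2l; apply: ler_wpM2l => //.
  by rewrite invr_ge0 mulr_ge0// ltW.
have -> : (2 * K)^-1 * (K * X) = X / 2 by field; rewrite gt_eqF.
lra.
Qed.

End op.

Section gram.
Variable v : T1 -> R.
Hypothesis iv : m1.-integrable [set: T1] (EFin \o v).
Hypothesis v0 : forall r, 0 <= v r.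
Hypothesis kvw : forall z, `|k z| <= v z.1 * w z.2.

Let mkk : measurable_fun [set: (T1 * T1) * T2]
  (fun q : (T1 * T1) * T2 => k (q.1.1, q.2) * k (q.1.2, q.2)).
Proof.
have m1' := @measurable_fst _ _ (T1 * T1)%type T2.
have m2' := @measurable_snd _ _ (T1 * T1)%type T2.
apply: measurable_funM; apply: (measurableT_comp mk); apply: measurable_fun_pair => //.
  exact: (measurableT_comp (@measurable_fst _ _ T1 T1) m1').
exact: (measurableT_comp (@measurable_snd _ _ T1 T1) m1').
Qed.

Let kkle q : `|k (q.1.1, q.2) * k (q.1.2, q.2)| <= (v q.1.1 * v q.1.2) * w q.2.
Proof.
have w0 : 0 <= w q.2 by case/andP: (w01 q.2).
have w1 : w q.2 <= 1 by case/andP: (w01 q.2).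
rewrite normrM; apply: (@le_trans _ _ ((v q.1.1 * w q.2) * (v q.1.2 * w q.2))).
  by apply: ler_pM => //; exact: (kvw (_, _)).
rewrite mulrACA; apply: ler_wpM2l; first exact: mulr_ge0.
by rewrite -[leRHS]mulr1; apply: ler_wpM2l.
Qed.

Lemma measurable_kernel_gram : measurable_fun [set: T1 * T1] kernel_gram.
Proof.
exact: (measurable_Rintegral_section m2 mkk).
Qed.

Lemma integrable_kernel_gram z :
  m2.-integrable [set: T2] (EFin \o (fun t => k (z.1, t) * k (z.2, t))).
Proof.
exact: (dominated_integrable1 (phi := fun z => v z.1 * v z.2) mkk iw kkle z).
Qed.

Lemma kernel_gram_le z : `|kernel_gram z| <= \int[m2]_t w t.
Proof.
have ik := integrable_kernel_gram z.
apply: le_trans (le_normr_Rintegral _ ik) _ => //.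
apply: le_Rintegral => //; first exact: integrable_norm ik.
move=> t _; rewrite normrM -[leRHS]mul1r; by apply: ler_pM => //; exact: (kw (_, _)).
Qed.
End gram.
End adjoint.

(** * Damped oscillations *)
Section damped_cosine.
Context {R : realType}.
Let mu := @lebesgue_measure R.

Lemma is_derive_damping (a t : R) :
  is_derive t 1 (fun s => expR (- (a * s))) (- a * expR (- (a * t))).
Proof.
have h : is_derive t 1 (fun s : R => - (a * s)) (- a).
  have -> : (fun s : R => - (a * s)) = - (a *: (@id R)) by [].
  by apply: is_derive_eq; rewrite /GRing.scale/= mulr1.
have := @is_derive1_comp _ expR (fun s => - (a * s)) t _ _ (is_derive_expR _) h.
by move=> h'; apply: (is_derive_eq h'); rewrite mulrC.
Qed.

Lemma is_derive_cos_scale (b t : R) :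
  is_derive t 1 (fun s => cos (b * s)) (- b * sin (b * t)).
Proof.
have h : is_derive t 1 (fun s : R => b * s) b.
  have -> : (fun s : R => b * s) = b *: (@id R) by [].
  by apply: is_derive_eq; rewrite /GRing.scale/= mulr1.
have := @is_derive1_comp _ cos (fun s => b * s) t _ _ (is_derive_cos _) h.
by move=> h'; apply: (is_derive_eq h'); rewrite mulrC mulrN mulNr.
Qed.

Lemma is_derive_sin_scale (b t : R) :
  is_derive t 1 (fun s => sin (b * s)) (b * cos (b * t)).
Proof.
have h : is_derive t 1 (fun s : R => b * s) b.
  have -> : (fun s : R => b * s) = b *: (@id R) by [].
  by apply: is_derive_eq; rewrite /GRing.scale/= mulr1.
have := @is_derive1_comp _ sin (fun s => b * s) t _ _ (is_derive_sin _) h.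
by move=> h'; apply: (is_derive_eq h'); rewrite mulrC.
Qed.

Lemma cvgy_damping (a : R) : 0 < a -> expR (- (a * t)) @[t --> +oo] --> (0 : R).
Proof.
move=> a0; apply: (@cvg_comp _ _ _ (fun t => a * t) (fun s => expR (- s)) _ +oo).
  by apply: gt0_cvgMry => //; exact: cvg_id.
exact: cvgr_expR.
Qed.

Lemma continuous_damping (a : R) : continuous (fun t : R => expR (- (a * t))).
Proof.
move=> t; apply/differentiable_continuous/derivable1_diffP.
by have [] := is_derive_damping a t.
Qed.

Lemma continuous_cos_scale (b : R) : continuous (fun t : R => cos (b * t)).
Proof.
move=> t; apply/differentiable_continuous/derivable1_diffP.
by have [] := is_derive_cos_scale b t.
Qed.

(** The constant 1 makes the integrand nonnegative, so that its integral over the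
half-line is the limit of a primitive; the damped cosine itself is the
difference of the cases c = 1 and c = 0. *)
Lemma integral_damped_1Dcos (a b c : R) : 0 < a -> 0 <= c <= 1 ->
  (\int[mu]_(t in `[0%R, +oo[) (expR (- (a * t)) * (1 + c * cos (b * t)))%:E =
  (c * (a / (a ^+ 2 + b ^+ 2)) + a^-1)%:E)%E.
Proof.
move=> a0 /andP[c0 c1].
have D0 : 0 < a ^+ 2 + b ^+ 2 by rewrite ltr_pwDl ?sqr_ge0// exprn_gt0.
pose D := (a ^+ 2 + b ^+ 2)^-1.
pose f (t : R) := expR (- (a * t)) * (1 + c * cos (b * t)).
pose F (t : R) := expR (- (a * t)) *
  (c * D * (b * sin (b * t) - a * cos (b * t)) - a^-1).
have cf : continuous f.
  move=> t; apply: cvgM; first exact: continuous_damping.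
  apply: cvgD; first exact: cvg_cst.
  by apply: cvgM; [exact: cvg_cst|exact: continuous_cos_scale].
have dF (t : R) : is_derive t 1 F (f t).
  have d1 := is_derive_damping a t.
  have d2 := is_derive_cos_scale b t.
  have d3 := is_derive_sin_scale b t.
  have -> : F = (fun s => expR (- (a * s))) *
     ((c * D) *: (b *: (fun s => sin (b * s)) - a *: (fun s => cos (b * s)))
       - cst a^-1) by [].
  apply: is_derive_eq; rewrite /f !fctE /= /GRing.scale/= subr0.
  have -> : expR (- (a * t)) * (1 + c * cos (b * t)) =
    expR (- (a * t)) * (a * a^-1 + c * (D * (a ^+ 2 + b ^+ 2)) * cos (b * t)).
    by rewrite /D mulVf ?gt_eqF// mulfV ?gt_eqF// mulr1.
  ring.
have cF : continuous F.
  move=> t; apply/differentiable_continuous/derivable1_diffP.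
  by have [] := dF t.
rewrite (@ge0_continuous_FTC2y _ f F 0 0).
- rewrite -EFinB /F mulr0 oppr0 expR0 mulr0 sin0 cos0; congr EFin.
  by rewrite -/D; ring.
- move=> t _; rewrite mulr_ge0 ?expR_ge0//.
  have := cos_geN1 (b * t); nra.
- exact: continuous_subspaceT.
- apply/cvgr0Pnorm_le => e e0.
  pose B := c * D * (`|b| + a) + a^-1.
  have B0 : 0 < B.
    by rewrite ltr_wpDl ?invr_gt0// mulr_ge0 ?mulr_ge0 ?addr_ge0 ?invr_ge0// ltW.
  have eB0 : 0 < e / B by rewrite divr_gt0.
  have /cvgr0Pnorm_le /(_ _ eB0) := cvgy_damping a0.
  apply: filterS => t; rewrite ler_pdivlMr// => ht.
  rewrite /F normrM; apply: le_trans ht.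
  apply: ler_wpM2l => //; rewrite /B.
  apply: le_trans (ler_normB _ _) _.
  have ai0 : 0 <= a^-1 by rewrite invr_ge0 ltW.
  have cD0 : 0 <= c * D by rewrite mulr_ge0 // invr_ge0 ltW.
  rewrite (ger0_norm ai0) lerD2r normrM (ger0_norm cD0).
  apply: ler_wpM2l => //.
  apply: le_trans (ler_normB _ _) _; rewrite !normrM (gtr0_norm a0).
  apply: lerD; rewrite -[leRHS]mulr1; apply: ler_wpM2l => //.
  + by rewrite ler_norml sin_geN1 sin_le1.
  + exact: ltW.
  + by rewrite ler_norml cos_geN1 cos_le1.
- by move=> t _; have [] := dF t.
- by apply: cvg_at_right_filter; exact: cF.
- by move=> t _; rewrite derive1E; exact: derive_val.
Qed.
End damped_cosine.

Section indicator.
Context d (T : measurableType d) (R : realType) (m : {measure set T -> \bar R}).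

Lemma integral_indicM (A : set T) (f : T -> R) :
  (\int[m]_t (\1_A t * f t)%:E = \int[m]_(t in A) (f t)%:E)%E.
Proof.
rewrite [RHS]integral_mkcond; apply: eq_integral => t _.
by rewrite patchE indicE; case: (t \in A); rewrite ?mul1r ?mul0r.
Qed.

Lemma Rintegral_indicM (A : set T) (f : T -> R) :
  \int[m]_t (\1_A t * f t) = \int[m]_(t in A) f t.
Proof. by rewrite /Rintegral integral_indicM. Qed.

Lemma indic01 (A : set T) t : 0 <= (\1_A t : R) <= 1.
Proof. by rewrite indicE; case: (t \in A); rewrite ?lexx ?ler01. Qed.

End indicator.

Section osc.
Context {R : realType}.
Let mu := @lebesgue_measure R.
Local Notation RT := (measurableTypeR R).

(** Cosine and sine are treated as the two values of one family, since every bound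
below is needed for both. *)
Definition osc (b : bool) (s : R) : R := if b then cos s else sin s.

Lemma osc_le1 b s : `|osc b s| <= 1.
Proof.
by case: b; rewrite ler_norml /osc ?cos_geN1 ?cos_le1 ?sin_geN1 ?sin_le1.
Qed.

Lemma continuous_osc b : continuous (osc b).
Proof. by case: b => s; [exact: continuous_cos|exact: continuous_sin]. Qed.

Lemma measurable_osc b : measurable_fun [set: R] (osc b).
Proof. by apply: continuous_measurable_fun; exact: continuous_osc. Qed.

Definition damped (b : bool) (x y t : R) : R :=
  \1_Rpos t * (expR (- (x * t)) * osc b (y * t)).

Definition decay (e t : R) : R := \1_(@Rpos R) t * expR (- (e * t)).

Lemma measurable_Rpos : measurable (@Rpos R).
Proof. exact: measurable_itv. Qed.

Lemma Rpos_gt0 (t : R) : Rpos t -> 0 < t.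
Proof. by rewrite /Rpos /= in_itv/= andbT. Qed.

Lemma decay01 e t : 0 <= e -> 0 <= decay e t <= 1.
Proof.
move=> e0; rewrite /decay indicE; have [tp|tp] := boolP (t \in _); last first.
  by rewrite mul0r lexx ler01.
rewrite mul1r expR_ge0 -[leRHS]expR0 ler_expR oppr_le0 mulr_ge0//.
by apply: ltW; apply: Rpos_gt0; exact: set_mem.
Qed.

Lemma damped_le b x y e t : e <= x -> `|damped b x y t| <= decay e t.
Proof.
move=> ex; rewrite /damped /decay indicE; have [tp|tp] := boolP (t \in _); last first.
  by rewrite !mul0r normr0.
rewrite !mul1r normrM ger0_norm ?expR_ge0// -[leRHS]mulr1.
apply: ler_pM; rewrite ?expR_ge0 ?osc_le1//.
rewrite ler_expR lerN2 ler_wpM2r//.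
by apply: ltW; apply: Rpos_gt0; exact: set_mem.
Qed.

Lemma measurable_damping (a : R) :
  measurable_fun [set: R] (fun t : R => expR (- (a * t))).
Proof. by apply: continuous_measurable_fun; exact: continuous_damping. Qed.

Lemma measurable_cos_scale (b : R) :
  measurable_fun [set: R] (fun t : R => cos (b * t)).
Proof. by apply: continuous_measurable_fun; exact: continuous_cos_scale. Qed.

Lemma integral_Rpos_damped (a b c : R) : 0 < a -> 0 <= c <= 1 ->
  (\int[mu]_t (\1_Rpos t * (expR (- (a * t)) * (1 + c * cos (b * t))))%:E =
  (c * (a / (a ^+ 2 + b ^+ 2)) + a^-1)%:E)%E.
Proof.
move=> a0 c01; rewrite integral_indicM /Rpos integral_itv_obnd_cbnd.
  exact: integral_damped_1Dcos.
apply/measurable_EFinP; apply: measurable_funTS.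
apply: measurable_funM; first exact: measurable_damping.
apply: measurable_funD => //; apply: measurable_funM => //.
exact: measurable_cos_scale.
Qed.

Lemma integrable_Rpos_damped (a b c : R) : 0 < a -> 0 <= c <= 1 ->
  mu.-integrable [set: R] (EFin \o
     (fun t => \1_Rpos t * (expR (- (a * t)) * (1 + c * cos (b * t))))).
Proof.
move=> a0 c01; apply/integrableP; split.
  apply/measurable_EFinP; apply: measurable_funM.
    by apply: measurable_indic; exact: measurable_Rpos.
  apply: measurable_funM; first exact: measurable_damping.
  apply: measurable_funD => //; apply: measurable_funM => //.
  exact: measurable_cos_scale.
under eq_integral => t _.
  rewrite /= ger0_norm; last first.
    have [c0 c1] := andP c01; have [i0 _] := andP (@indic01 _ _ R (@Rpos R) t).
    rewrite mulr_ge0// mulr_ge0 ?expR_ge0//.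
    have := cos_geN1 (b * t); nra.
  over.
by rewrite integral_Rpos_damped// ltry.
Qed.

Lemma integrable_decay (e : R) : 0 < e ->
  mu.-integrable [set: R] (EFin \o decay e).
Proof.
move=> e0; have h01 : 0 <= (0 : R) <= 1 by apply/andP; split.
apply: eq_integrable (integrable_Rpos_damped 0 e0 h01) => // t _ /=.
by rewrite /decay mul0r addr0 mulr1.
Qed.

Lemma Rintegral_damped_cos (a b : R) : 0 < a ->
  \int[mu]_t damped true a b t = a / (a ^+ 2 + b ^+ 2).
Proof.
move=> a0; have h0 : 0 <= (0 : R) <= 1 by apply/andP; split.
have h1 : 0 <= (1 : R) <= 1 by apply/andP; split.
have i1 := integrable_Rpos_damped b a0 h1.
have i0 := integrable_Rpos_damped b a0 h0.
have := RintegralB measurableT i1 i0.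
rewrite /Rintegral !integral_Rpos_damped//= mul1r mul0r add0r addrK => <-.
congr fine; apply: eq_integral => t _; congr EFin.
by rewrite /damped /osc; ring.
Qed.

Lemma measurable_damped b : measurable_fun [set: (R * R) * R]
  (fun q : (R * R) * R => damped b q.1.1 q.1.2 q.2).
Proof.
have m1 := @measurable_fst _ _ (RT * RT)%type RT.
have m2 : measurable_fun [set: (R * R) * R] (fun q : (R * R) * R => q.2) :=
  @measurable_snd _ _ (RT * RT)%type RT.
have mx : measurable_fun [set: (R * R) * R] (fun q : (R * R) * R => q.1.1).
  exact: (measurableT_comp (@measurable_fst _ _ RT RT) m1).
have my : measurable_fun [set: (R * R) * R] (fun q : (R * R) * R => q.1.2).
  exact: (measurableT_comp (@measurable_snd _ _ RT RT) m1).
apply: measurable_funM.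
  have mi : measurable_fun [set: R] (\1_Rpos : R -> R).
    by apply: measurable_indic; exact: measurable_Rpos.
  exact: (measurableT_comp mi m2).
apply: measurable_funM.
  apply: measurableT_comp => //; apply: measurable_funN.
  exact: measurable_funM.
apply: (measurableT_comp (measurable_osc b)).
exact: measurable_funM.
Qed.

End osc.

(** * The L^2 bound for the linearized Laplace transform *)
Section linearized.
Context {R : realType}.
Let mu := @lebesgue_measure R.
Local Notation RT := (measurableTypeR R).
Variables (x y : R -> R) (E : set R) (e : R).
Hypothesis mx : measurable_fun [set: R] x.
Hypothesis my : measurable_fun [set: R] y.
Hypothesis mE : measurable E.
Hypothesis muE : (mu E < +oo)%E.
Hypothesis e0 : 0 < e.
Hypothesis xe : forall r, E r -> e <= x r.
Hypothesis dist_ge : forall r s, E r -> E s -> (r - s) ^+ 2 <= refl_dist2 x y r s.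

Definition lap_kernel b (z : R * R) : R :=
  \1_E z.1 * damped b (x z.1) (y z.1) z.2.

Lemma lap_kernel_le b z : `|lap_kernel b z| <= \1_E z.1 * decay e z.2.
Proof.
rewrite /lap_kernel indicE; have [Ez|Ez] := boolP (_ \in E); last first.
  by rewrite !mul0r normr0.
by rewrite !mul1r; apply: damped_le; apply: xe; exact: set_mem.
Qed.

Lemma lap_kernel_le_decay b z : `|lap_kernel b z| <= decay e z.2.
Proof.
apply: le_trans (lap_kernel_le b z) _; rewrite -[leRHS]mul1r.
apply: ler_wpM2r; first by have /andP[] := decay01 z.2 (ltW e0).
by have /andP[] := indic01 R E z.1.
Qed.

Lemma measurable_lap_kernel b : measurable_fun [set: R * R] (lap_kernel b).
Proof.
have m1 (h : R -> R) : measurable_fun [set: R] h ->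
    measurable_fun [set: R * R] (fun z : R * R => h z.1).
  by move=> mh; exact: (measurableT_comp mh (@measurable_fst _ _ RT RT)).
apply: measurable_funM; first by apply: m1; exact: measurable_indic.
exact: (measurableT_comp (measurable_damped b) (measurable_fun_pair
  (measurable_fun_pair (m1 _ mx) (m1 _ my)) (@measurable_snd _ _ RT RT))).
Qed.

Let idec := integrable_decay e0.
Let dec01 t := decay01 t (ltW e0).

Lemma integrable_indic_finite : mu.-integrable [set: R] (EFin \o (\1_E : R -> R)).
Proof.
apply/integrableP; split; first by apply/measurable_EFinP; exact: measurable_indic.
under eq_integral => t _ do rewrite /= ger0_norm ?(andP (indic01 R E t)).1//.
by rewrite integral_indic// setIT.
Qed.

(** cos cos + sin sin is the cosine of the difference of phases, so that the two Gram
kernels add up to Re (1 / (z(r) + conj z(s))), which is positive. *)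
Lemma lap_gram r s :
  kernel_gram (T1 := RT) mu (lap_kernel true) (r, s) +
  kernel_gram (T1 := RT) mu (lap_kernel false) (r, s)
  = refl_kernel x y E (r, s) + refl_kernel x y E (s, r).
Proof.
have E0 u : 0 <= (\1_E u : R) by case/andP: (indic01 R E u).
have ik b := integrable_kernel_gram (T1 := RT) (T2 := RT) (measurable_lap_kernel b) idec dec01
  E0 (lap_kernel_le b) (r, s).
rewrite /kernel_gram -(RintegralD measurableT (ik true) (ik false)) /=.
transitivity (\int[mu]_t (\1_E r * \1_E s *
   damped true (x r + x s) (y r - y s) t)).
  apply: eq_Rintegral => t _; rewrite /lap_kernel /= /damped /osc.
  rewrite mulrDl opprD expRD mulrBl cosB.
  rewrite [\1_Rpos _]indicE; case: (t \in _); rewrite ?mul1r ?mul0r; ring.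
have [[Er Es]|h] := pselect (E r /\ E s); last first.
  rewrite !refl_kernel_out//; last by case=> Es Er; exact: h.
  rewrite addr0 (_ : (fun t => _) = cst 0); last first.
    apply/funext => t; rewrite !indicE.
    have [Er|Er] := pselect (E r); last by rewrite memNset// !mul0r.
    by rewrite [s \in E]memNset ?mulr0 ?mul0r// => Es; exact: h.
  by rewrite /Rintegral integral0.
rewrite !refl_kernelE// (refl_dist2C x y s r) -mulrDl.
under eq_Rintegral do rewrite !indicE !mem_set// !mul1r.
by rewrite Rintegral_damped_cos// addr_gt0// (lt_le_trans e0)// xe.
Qed.

(** The other of the two adjoints contributes a nonnegative square, and the form of a
positive kernel only increases when G is replaced by |G|. *)
Lemma lap_adj_energy b (G : R -> R) (M : R) : measurable_fun [set: R] G ->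
  (forall r, `|G r| <= M * \1_E r) ->
  \int[mu]_t (kernel_adj (T2 := RT) mu (lap_kernel b) G t ^+ 2) <=
    16 * pi * \int[mu]_r (G r ^+ 2).
Proof.
move=> mG GM; have iE := integrable_indic_finite.
have E01 (r : R) := indic01 R E r.
have E0 (r : R) : 0 <= (\1_E r : R) by case/andP: (E01 r).
have iG2 := integrable_sqr_supp (T1 := RT) iE E01 mG GM.
have iG : mu.-integrable [set: R] (EFin \o G).
  have h := integrableZl measurableT M iE.
  apply: (le_integrable measurableT _ _ h); first exact/measurable_EFinP.
  by move=> r _; rewrite /= lee_fin (le_trans (GM r))// ler_norm.
have iGn := integrable_norm iG.
have mk := measurable_lap_kernel.
have kw := lap_kernel_le_decay.
pose Q c := kernel_gram (T1 := RT) mu (lap_kernel c).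
pose W := \int[mu]_t decay e t.
have mQ c : measurable_fun [set: R * R] (Q c).
  exact: (measurable_kernel_gram (T1 := RT) (T2 := RT) mu (mk c)).
have QW c z : `|Q c z| <= W.
  exact: (kernel_gram_le (T1 := RT) (T2 := RT) (mk c) idec dec01 (kw c) E0 (lap_kernel_le c)).
have iH c := integrable_sqr_kernel_adj (T1 := RT) (T2 := RT) (mk c) idec dec01 (kw c) iG.
have sum2 (I : bool -> R) : (forall c, 0 <= I c) -> I b <= I true + I false.
  by move=> I0; case: b; rewrite ?lerDl ?lerDr I0.
apply: le_trans
  (sum2 (fun c => \int[mu]_t (kernel_adj (T2 := RT) mu (lap_kernel c) G t ^+ 2)) _) _.
  by move=> c; apply: Rintegral_ge0 => t _; exact: sqr_ge0.
rewrite !(kernel_adj_energy (T1 := RT) (T2 := RT) (mk _) idec dec01 (kw _) iG).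
have mfst := @measurable_fst _ _ (measurableTypeR R) (measurableTypeR R).
have msnd := @measurable_snd _ _ (measurableTypeR R) (measurableTypeR R).
have mG1 : measurable_fun [set: R * R] (fun z : R * R => G z.1).
  exact: (measurableT_comp mG mfst).
have mG2 : measurable_fun [set: R * R] (fun z : R * R => G z.2).
  exact: (measurableT_comp mG msnd).
have iWG := integrableZl measurableT W iGn.
pose F c (z : R * R) := G z.1 * G z.2 * Q c z.
have mF c : measurable_fun [set: R * R] (F c).
  by apply: measurable_funM => //; exact: measurable_funM.
have FW c z : `|F c z| <= `|G z.1| * (W * `|G z.2|).
  rewrite !normrM -mulrA ler_wpM2l// mulrC ler_wpM2r//; exact: QW.
have iF1 c r := dominated_integrable1 (T1 := RT) (T2 := RT) (m2 := mu)
  (phi := fun r => `|G r|) (mF c) iWG (FW c) r.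
have iFF c := dominated_integrable_Fubini1 (T1 := RT) (T2 := RT) (mF c) iGn iWG (FW c).
rewrite -(RintegralD measurableT (iFF true) (iFF false)).
pose P (z : R * R) := refl_kernel x y E z + refl_kernel x y E (z.2, z.1).
pose g r := `|G r|.
have g0 r : 0 <= g r by exact: normr_ge0.
have g0M r : 0 <= g r <= `|M|.
  rewrite g0 /=; apply: le_trans (GM r) _; apply: le_trans (ler_norm _) _.
  by rewrite normrM ler_piMr// ger0_norm//; case/andP: (E01 r).
have mg : measurable_fun [set: R] g by exact: measurableT_comp.
have H := refl_energy_le mx my mE muE e0 xe dist_ge mg g0M.
have FE r s : F true (r, s) + F false (r, s) = G r * G s * P (r, s).
  by rewrite /F /= -mulrDr lap_gram.
have P0 z : 0 <= P z by apply: addr_ge0; exact: (refl_kernel_ge0 y e0 xe).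
have PW z : P z <= 2 * W.
  case: z => r s; rewrite /P /= -lap_gram mulr_natl mulr2n.
  by apply: lerD; apply: le_trans (ler_norm _) (QW _ _).
have mP : measurable_fun [set: R * R] P.
  apply: measurable_funD; first exact: measurable_refl_kernel.
  apply: (measurableT_comp (measurable_refl_kernel _ _ _)) => //.
  exact: measurable_swap.
pose F' (z : R * R) := g z.1 * g z.2 * P z.
have mF' : measurable_fun [set: R * R] F'.
  apply: measurable_funM => //; apply: measurable_funM.
    exact: (measurableT_comp mg mfst).
  exact: (measurableT_comp mg msnd).
have i2Wg := integrableZl measurableT (2 * W) iGn.
have F'W z : `|F' z| <= g z.1 * (2 * W * g z.2).
  rewrite ger0_norm; last by rewrite /F' !mulr_ge0.
  by rewrite /F' -mulrA ler_wpM2l// mulrC ler_wpM2r.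
have iF' r := dominated_integrable1 (T1 := RT) (T2 := RT) (m2 := mu)
  (phi := g) mF' i2Wg F'W r.
have iFF' := dominated_integrable_Fubini1 (T1 := RT) (T2 := RT) mF' iGn i2Wg F'W.
apply: (@le_trans _ _ (\int[mu]_r \int[mu]_s F' (r, s))).
  apply: (le_Rintegral measurableT _ iFF').
    apply: eq_integrable (integrableD measurableT (iFF true) (iFF false)) => //.
  move=> r _; rewrite -(RintegralD measurableT (iF1 true r) (iF1 false r)).
  apply: (le_Rintegral measurableT _ (iF' r)).
    apply: eq_integrable (integrableD measurableT (iF1 true r) (iF1 false r)) => //.
  move=> s _; rewrite FE /F' /g -normrM /=.
  by apply: ler_wpM2r => //; exact: ler_norm.
have iF'E : (\int[mu]_r \int[mu]_s (F' (r, s))%:E =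
    (\int[mu]_r \int[mu]_s F' (r, s))%:E)%E.
  rewrite [in RHS]/Rintegral fineK; last exact/integrable_fin_num/iFF'.
  apply: eq_integral => r _; rewrite /Rintegral fineK//.
  exact/integrable_fin_num/iF'.
rewrite -lee_fin -iF'E; apply: le_trans H _.
rewrite [leRHS]EFinM; apply: lee_wpmul2l.
  by rewrite lee_fin mulr_ge0// pi_ge0.
rewrite /Rintegral fineK; last exact/integrable_fin_num/iG2.
rewrite le_eqVlt; apply/orP; left; apply/eqP; apply: eq_integral => r _.
by rewrite /g real_normK ?num_real.
Qed.

End linearized.

(** * Interpolation between L^1 and L^2 *)
Section dyadic.
Context {R : realType}.

Lemma dyadic_bracket (c h : R) m : c < h -> h <= c * 2 ^+ m ->
  exists2 k, (k < m)%N & c * 2 ^+ k < h <= 2 * (c * 2 ^+ k).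
Proof.
elim: m => [|m IHm] ch; first by rewrite expr0 mulr1 leNgt ch.
have [hm _|hm hm1] := leP h (c * 2 ^+ m).
  by have [k km kh] := IHm ch hm; exists k => //; exact: ltnW.
by exists m => //; rewrite hm /= (le_trans hm1)// exprS mulrCA.
Qed.

(** The terms that are at most X form an initial segment of a geometric progression,
so that the last of them controls the sum. *)
Lemma truncated_geometric_sum (c rho X : R) m : 0 <= c -> 1 < rho -> 0 <= X ->
  \sum_(k < m) (if c * rho ^+ k <= X then c * rho ^+ k else 0) <=
  X * (rho / (rho - 1)).
Proof.
move=> c0 rho1 X0; have r0 : 0 < rho - 1 by rewrite subr_gt0.
have h n : \sum_(k < n) (if c * rho ^+ k <= X then c * rho ^+ k else 0) <=
    c * rho ^+ n / (rho - 1).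
  elim: n => [|n IHn].
    by rewrite big_ord0 expr0 mulr1 divr_ge0// ltW.
  have -> : c * rho ^+ n.+1 / (rho - 1) = c * rho ^+ n / (rho - 1) + c * rho ^+ n.
    by rewrite exprS; field; rewrite gt_eqF.
  rewrite big_ord_recr /=; apply: lerD => //.
  by case: ifP => // _; rewrite mulr_ge0// exprn_ge0// ltW// (lt_trans _ rho1).
elim: m => [|m IHm].
  by rewrite big_ord0 mulr_ge0// divr_ge0 ?ltW// (lt_trans _ rho1).
case: (leP (c * rho ^+ m) X) => hX; last first.
  by rewrite big_ord_recr /= ifN ?addr0// -ltNge.
apply: le_trans (h m.+1) _.
have rr : 0 <= rho / (rho - 1) by rewrite divr_ge0 ?ltW// (lt_trans _ rho1).
have -> : c * rho ^+ m.+1 / (rho - 1) = c * rho ^+ m * (rho / (rho - 1)).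
  by rewrite exprS; ring.
exact: ler_wpM2r.
Qed.
End dyadic.

Section integrability.
Context d (T : measurableType d) (R : realType) (m : {measure set T -> \bar R}).
Variables (w : T -> R) (p : R) (u : T -> R).
Hypothesis iw : m.-integrable [set: T] (EFin \o w).
Hypothesis w01 : forall t, 0 <= w t <= 1.
Hypothesis p1 : 1 <= p.
Hypothesis iup : m.-integrable [set: T] (EFin \o (fun t => `|u t| `^ p)).

Lemma integrable_powR_decayM (v : T -> R) : measurable_fun [set: T] v ->
  (forall t, `|v t| <= `|u t|) ->
  m.-integrable [set: T] (EFin \o (fun t => `|v t| * w t)).
Proof.
move=> mv vu; have iS := integrableD measurableT iup iw.
have mw : measurable_fun [set: T] w.
  by apply/measurable_EFinP; case/integrableP : iw.
apply: (le_integrable measurableT _ _ iS).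
  by apply/measurable_EFinP; apply: measurable_funM => //; exact: measurableT_comp.
move=> t _; have [w0 w1] := andP (w01 t).
rewrite /= lee_fin ger0_norm ?mulr_ge0//; apply: le_trans _ (ler_norm _).
apply: (@le_trans _ _ (`|u t| * w t)); first exact: (ler_wpM2r w0 (vu t)).
have [a1|a1] := leP `|u t| 1.
  by apply: ler_wpDl; [exact: powR_ge0|rewrite ler_piMl].
apply: ler_wpDr => //; apply: (@le_trans _ _ `|u t|); first by rewrite ler_piMr.
by apply: le1r_powR; [exact: ltW|].
Qed.
End integrability.

Section interpolation.
Context d1 d2 (T1 : measurableType d1) (T2 : measurableType d2) (R : realType).
Variables (m1 : {sigma_finite_measure set T1 -> \bar R})
          (m2 : {sigma_finite_measure set T2 -> \bar R}).
Variables (k : T1 * T2 -> R) (w : T2 -> R).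
Hypothesis mk : measurable_fun [set: T1 * T2] k.
Hypothesis iw : m2.-integrable [set: T2] (EFin \o w).
Hypothesis w01 : forall t, 0 <= w t <= 1.
Hypothesis kw : forall z, `|k z| <= w z.2.
Variables (K p : R).
Hypothesis K0 : 0 <= K.
Hypothesis p12 : 1 < p < 2.
Hypothesis L2 : forall u : T2 -> R, measurable_fun [set: T2] u ->
  (\int[m2]_t (u t ^+ 2)%:E < +oo)%E ->
  (\int[m1]_r (kernel_op m2 k u r ^+ 2)%:E <= K%:E * \int[m2]_t (u t ^+ 2)%:E)%E.

Definition conj_exp : R := p / (p - 1).
(** The weights lam^(q - 2) of consecutive dyadic levels lam differ by this factor,
which exceeds 1 precisely because q > 2. *)
Definition interp_ratio : R := 2 `^ (conj_exp - 2).
Definition interp_cst : R := 4 * 2 `^ conj_exp * K * (interp_ratio / (interp_ratio - 1))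
  * 2 `^ (conj_exp - 2).

Local Notation q := conj_exp.
Let p1 : 1 < p. Proof. by case/andP: p12. Qed.
Let p2 : p < 2. Proof. by case/andP: p12. Qed.
Let pm0 : p - 1 != 0. Proof. by rewrite gt_eqF// subr_gt0. Qed.
Let p0 : 0 < p. Proof. exact: lt_trans p1. Qed.

Let q2E : q - 2 = (2 - p) / (p - 1).
Proof. by rewrite /q; field. Qed.

Let q2 : 0 < q - 2.
Proof. by rewrite q2E divr_gt0// subr_gt0. Qed.

Let rho1 : 1 < interp_ratio.
Proof.
have {1}-> : 1 = 1 `^ (q - 2) :> R by rewrite powR1.
by apply: gt0_ltr_powR; rewrite ?nnegrE// ltr1n.
Qed.

Lemma interp_cst_ge0 : 0 <= interp_cst.
Proof.
have S0 : 0 <= interp_ratio / (interp_ratio - 1).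
  by rewrite divr_ge0 ?subr_ge0 ?(ltW rho1)// (le_trans _ (ltW rho1)).
have h : 0 <= 4 * 2 `^ q * K by rewrite !mulr_ge0 ?powR_ge0.
exact: mulr_ge0 (mulr_ge0 h S0) (powR_ge0 _ _).
Qed.

Section fixed_function.
Variable u : T2 -> R.
Hypothesis meas_u : measurable_fun [set: T2] u.
Variable N : R.
Hypothesis uN : (\int[m2]_t (`|u t| `^ p)%:E = N%:E)%E.

Let meas_up : measurable_fun [set: T2] (fun t => `|u t| `^ p).
Proof. by apply: (measurableT_comp (measurable_powR p)); exact: measurableT_comp. Qed.

Let iup : m2.-integrable [set: T2] (EFin \o (fun t => `|u t| `^ p)).
Proof.
apply/integrableP; split; first exact/measurable_EFinP.
under eq_integral do rewrite /= ger0_norm ?powR_ge0//.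
by rewrite uN ltry.
Qed.

Let integrable_low (v : T2 -> R) : measurable_fun [set: T2] v ->
  (forall t, `|v t| <= `|u t|) ->
  m2.-integrable [set: T2] (EFin \o (fun t => `|v t| * w t)).
Proof. exact: integrable_powR_decayM iw w01 (ltW p1) iup v. Qed.

Section positive.
Hypothesis N0 : 0 < N.
Variable n : nat.

Let c0 : R := (2 ^+ n)^-1.
Let c0_gt0 : 0 < c0. Proof. by rewrite invr_gt0 exprn_gt0. Qed.
Let lam (j : nat) : R := c0 * 2 ^+ j.
Let lam_gt0 j : 0 < lam j. Proof. by rewrite mulr_gt0// exprn_gt0. Qed.

(** The part of u below the height (2 N / lam)^(1 / (p - 1)).  The height is chosen so
that the remaining part has L^1 norm at most lam / 2: where |T u| > lam, the
low part alone still contributes lam / 2. *)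
Definition low_part (j : nat) (t : T2) : R :=
  if lam j * `|u t| `^ (p - 1) <= 2 * N then u t else 0.

Let mlow j : measurable_fun [set: T2] (low_part j).
Proof.
apply: measurable_fun_ifT => //.
apply: measurable_fun_ler => //; apply: measurable_funM => //.
by apply: (measurableT_comp (measurable_powR (p - 1))); exact: measurableT_comp.
Qed.

Let low_le j t : `|low_part j t| <= `|u t|.
Proof. by rewrite /low_part; case: ifP => // _; rewrite normr0. Qed.

Let high_le j t : `|u t - low_part j t| <= lam j / (2 * N) * `|u t| `^ p.
Proof.
rewrite /low_part; have [h|h] := leP (lam j * `|u t| `^ (p - 1)) (2 * N).
  by rewrite subrr normr0 mulr_ge0 ?powR_ge0// divr_ge0 ?ltW// mulr_gt0.
rewrite subr0 -(mulr_powRB1 (normr_ge0 _) p0).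
rewrite mulrAC ler_pdivlMr ?mulr_gt0// [leRHS]mulrCA.
by rewrite ler_wpM2l// ltW.
Qed.

Let lam_pow j : lam j `^ (q - 2) = c0 `^ (q - 2) * interp_ratio ^+ j.
Proof.
rewrite /lam powRM ?(ltW c0_gt0) ?exprn_ge0//; congr (_ * _).
by rewrite /interp_ratio -(powR_mulrn j (ler0n R 2)) powRAC powR_mulrn// powR_ge0.
Qed.

(** The levels lam whose low part contains t are those with
lam^(q - 2) <= (2 N)^(q - 2) / |u(t)|^(2 - p), and (q - 2) (p - 1) = 2 - p. *)
Let low_sum m t : \sum_(j < m) lam j `^ (q - 2) * low_part j t ^+ 2 <=
  (2 * N) `^ (q - 2) * (interp_ratio / (interp_ratio - 1)) * `|u t| `^ p.
Proof.
have S0 : 0 <= interp_ratio / (interp_ratio - 1).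
  by rewrite divr_ge0 ?subr_ge0 ?(ltW rho1)// (le_trans _ (ltW rho1)).
have [u0|u0] := eqVneq (u t) 0.
  rewrite big1 => [|j _].
    exact: mulr_ge0 (mulr_ge0 (powR_ge0 _ _) S0) (powR_ge0 _ _).
  by rewrite /low_part u0 if_same expr0n mulr0.
have a0 : 0 < `|u t| by rewrite normr_gt0.
pose X := (2 * N) `^ (q - 2) / `|u t| `^ (2 - p).
have X0 : 0 <= X by rewrite divr_ge0 ?powR_ge0.
apply: (@le_trans _ _ (X * (interp_ratio / (interp_ratio - 1)) * `|u t| ^+ 2)).
  apply: le_trans (ler_wpM2r (sqr_ge0 _)
    (truncated_geometric_sum m (powR_ge0 c0 (q - 2)) rho1 X0)).
  rewrite mulr_suml; apply: ler_sum => j _.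
  rewrite /low_part; have [h|h] := leP (lam j * `|u t| `^ (p - 1)) (2 * N);
    last first.
    by rewrite expr0n mulr0 mulr_ge0 ?sqr_ge0//; case: ifP => // _;
      rewrite -lam_pow powR_ge0.
  rewrite real_normK ?num_real// -lam_pow ifT//.
  rewrite /X ler_pdivlMr ?powR_gt0//.
  have -> : `|u t| `^ (2 - p) = (`|u t| `^ (p - 1)) `^ (q - 2).
    by rewrite -powRrM q2E mulrC divfK.
  rewrite -powRM ?powR_ge0// ?(ltW (lam_gt0 _))//.
  apply: ge0_ler_powR; rewrite ?nnegrE ?mulr_ge0 ?powR_ge0// ?(ltW q2) ?(ltW N0)//.
  exact: ltW.
rewrite le_eqVlt; apply/orP; left; apply/eqP; rewrite /X.
have -> : `|u t| `^ p = `|u t| ^+ 2 / `|u t| `^ (2 - p).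
  rewrite -powR_mulrn// -powRB; first by congr (_ `^ _); ring.
  by apply/implyP => _; rewrite gt_eqF.
by ring.
Qed.

Let Tdiff j r :
  `|kernel_op m2 k u r| <= `|kernel_op m2 k (low_part j) r| + lam j / 2.
Proof.
have iu := integrable_kernel_op mk kw meas_u (integrable_low meas_u (fun t => lexx _)) r.
have il := integrable_kernel_op mk kw (mlow j) (integrable_low (mlow j) (low_le j)) r.
have iT := integrableZl measurableT (lam j / (2 * N)) iup.
have -> : kernel_op m2 k u r = kernel_op m2 k (low_part j) r +
    (kernel_op m2 k u r - kernel_op m2 k (low_part j) r).
  by rewrite addrC subrK.
apply: le_trans (ler_normD _ _) _; apply: lerD => //.
rewrite /kernel_op -(RintegralB measurableT iu il).
have idiff := integrableB measurableT iu il.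
apply: le_trans (le_normr_Rintegral measurableT idiff) _.
have -> : lam j / 2 = \int[m2]_t (lam j / (2 * N) * `|u t| `^ p).
  rewrite RintegralZl// /Rintegral uN /=.
  by field; rewrite gt_eqF.
apply: le_Rintegral => //; first exact: (integrable_norm idiff).
move=> t _; rewrite -mulrBl normrM; apply: le_trans (high_le j t).
rewrite ler_piMr//; apply: le_trans (kw _) _.
by case/andP: (w01 t).
Qed.

(** On the dyadic level lam < |T u| <= 2 lam one has
|T u|^q <= 2^q lam^q <= 4 2^q lam^(q - 2) |T low_part|^2. *)
Let level_le r : c0 < `|kernel_op m2 k u r| -> `|kernel_op m2 k u r| <= 2 ^+ n ->
  `|kernel_op m2 k u r| `^ q <= \sum_(j < n.*2)
     4 * 2 `^ q * (lam j `^ (q - 2) * kernel_op m2 k (low_part j) r ^+ 2).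
Proof.
move=> h1 h2.
have h3 : `|kernel_op m2 k u r| <= c0 * 2 ^+ n.*2.
  by rewrite -addnn exprD mulrA mulVf ?mul1r// gt_eqF// exprn_gt0.
have [j jn /andP[l1 l2]] := dyadic_bracket h1 h3.
rewrite -/(lam j) in l1 l2.
rewrite (bigD1 (Ordinal jn))//= -[leLHS]addr0; apply: lerD; last first.
  apply: sumr_ge0 => i _.
  by apply: mulr_ge0; apply: mulr_ge0; rewrite ?powR_ge0 ?sqr_ge0.
apply: (@le_trans _ _ ((2 * lam j) `^ q)).
  apply: ge0_ler_powR; rewrite ?nnegrE//; last by rewrite mulr_ge0// ltW.
  by rewrite -[q](subrK 2) addr_ge0 ?ltW.
rewrite powRM// ?(ltW (lam_gt0 j))//.
have -> : lam j `^ q = lam j `^ (q - 2) * lam j ^+ 2.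
  rewrite -powR_mulrn ?(ltW (lam_gt0 j))// -powRD ?subrK//.
  by apply/implyP => _; rewrite gt_eqF.
rewrite [4 * _]mulrC -mulrA; apply: ler_wpM2l; first exact: powR_ge0.
rewrite [leRHS]mulrCA; apply: ler_wpM2l; first exact: powR_ge0.
have := Tdiff j r; have := lam_gt0 j.
rewrite -(real_normK (num_real (kernel_op m2 k (low_part j) r))).
move: l1; move: `|_| `|_| => b a l1 l0 l3.
have hb : lam j / 2 <= b by lra.
have : lam j ^+ 2 / 4 <= b ^+ 2.
  have -> : lam j ^+ 2 / 4 = (lam j / 2) ^+ 2 by field.
  have lam20 : 0 <= lam j / 2 by rewrite divr_ge0// ltW.
  by rewrite ler_sqr ?nnegrE// (le_trans lam20).
lra.
Qed.

(** Only the values of |T u| between 2^-n and 2^n are counted, so that finitely many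
dyadic levels occur; the bound does not depend on n. *)
Lemma level_bound :
  (\int[m1]_r (if (c0 < `|kernel_op m2 k u r|) && (`|kernel_op m2 k u r| <= 2 ^+ n)
     then `|kernel_op m2 k u r| `^ q else 0)%:E <= (interp_cst * N `^ (q - 1))%:E)%E.
Proof.
have mT v : measurable_fun [set: T2] v -> measurable_fun [set: T1] (kernel_op m2 k v).
  by move=> mv; exact: measurable_kernel_op.
pose c j := 4 * 2 `^ q * lam j `^ (q - 2).
have c_ge0 j : 0 <= c j by rewrite /c !mulr_ge0 ?powR_ge0.
have cterm j r : 0 <= c j * kernel_op m2 k (low_part j) r ^+ 2.
  by rewrite mulr_ge0 ?sqr_ge0.
have mterm j : measurable_fun [set: T1]
    (fun r => (c j * kernel_op m2 k (low_part j) r ^+ 2)%:E).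
  apply/measurable_EFinP; apply: measurable_funM => //.
  by apply: measurable_funX; apply: mT.
have mnT : measurable_fun [set: T1] (fun r => `|kernel_op m2 k u r|).
  by apply: measurableT_comp => //; apply: mT.
pose D := (2 * N) `^ (q - 2) * (interp_ratio / (interp_ratio - 1)).
have lowE t : ((4 * 2 `^ q * (D * `|u t| `^ p))%:E =
   (4 * 2 `^ q * D)%:E * (`|u t| `^ p)%:E)%E.
  by rewrite -EFinM mulrA.
have D0 : 0 <= D.
  rewrite mulr_ge0 ?powR_ge0// divr_ge0 ?subr_ge0 ?(ltW rho1)//.
  exact: le_trans (ltW rho1).
have ilow2 j : (\int[m2]_t (low_part j t ^+ 2)%:E < +oo)%E.
  have iZ := integrableZl measurableT ((lam j `^ (q - 2))^-1 * D) iup.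
  apply: integrable_lty => //.
  apply: (le_integrable measurableT _ _ iZ).
    by apply/measurable_EFinP; apply: measurable_funX; exact: mlow.
  move=> t _; rewrite /= lee_fin ger0_norm ?sqr_ge0//.
  apply: le_trans (ler_norm _).
  rewrite -mulrA mulrC ler_pdivlMr ?powR_gt0// mulrC.
  apply: le_trans (low_sum j.+1 t); rewrite big_ord_recr /= lerDr.
  by apply: sumr_ge0 => i _; rewrite mulr_ge0 ?powR_ge0 ?sqr_ge0.
apply: (@le_trans _ _ (\int[m1]_r (\sum_(j < n.*2)
     (c j * kernel_op m2 k (low_part j) r ^+ 2)%:E))%E).
  apply: (ge0_le_integral m1 measurableT).
  - by move=> r _; rewrite lee_fin; case: ifP => // _; exact: powR_ge0.
  - apply/measurable_EFinP; apply: measurable_fun_ifT => //.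
      by apply: measurable_and; [exact: measurable_fun_ltr|exact: measurable_fun_ler].
    exact: (measurableT_comp (measurable_powR q)).
  - exact: emeasurable_sum.
  move=> r _; rewrite sumEFin lee_fin; case: ifPn => [/andP[h1 h2]|_].
    apply: le_trans (level_le h1 h2) _.
    by apply: ler_sum => j _; rewrite /c mulrA.
  by apply: sumr_ge0.
rewrite ge0_integral_sum//; last by move=> j r _; rewrite lee_fin.
apply: (@le_trans _ _ (\sum_(j < n.*2)
    (K%:E * \int[m2]_t (c j * low_part j t ^+ 2)%:E))%E).
  apply: lee_sum => j _.
  have -> : (\int[m1]_r (c j * kernel_op m2 k (low_part j) r ^+ 2)%:E =
      (c j)%:E * \int[m1]_r (kernel_op m2 k (low_part j) r ^+ 2)%:E)%E.
    under eq_integral do rewrite EFinM.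
    rewrite ge0_integralZl_EFin//; first by move=> r _; rewrite lee_fin sqr_ge0.
    by apply/measurable_EFinP; apply: measurable_funX; apply: mT.
  have -> : (\int[m2]_t (c j * low_part j t ^+ 2)%:E =
      (c j)%:E * \int[m2]_t (low_part j t ^+ 2)%:E)%E.
    under eq_integral do rewrite EFinM.
    rewrite ge0_integralZl_EFin//; first by move=> r _; rewrite lee_fin sqr_ge0.
    by apply/measurable_EFinP; apply: measurable_funX; exact: mlow.
  rewrite muleCA; apply: lee_wpmul2l; first by rewrite lee_fin.
  exact: L2.
rewrite -ge0_sume_distrr; last first.
  by move=> j _; apply: integral_ge0 => t _; rewrite lee_fin mulr_ge0 ?sqr_ge0.
rewrite -ge0_integral_sum//; last 2 first.
- move=> j; apply/measurable_EFinP; apply: measurable_funM => //.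
  by apply: measurable_funX; exact: mlow.
- by move=> j t _; rewrite lee_fin mulr_ge0 ?sqr_ge0.
apply: (@le_trans _ _ (K%:E * \int[m2]_t ((4 * 2 `^ q * D)%:E * (`|u t| `^ p)%:E))%E).
  apply: lee_wpmul2l; first by rewrite lee_fin.
  apply: (ge0_le_integral m2 measurableT).
  - by move=> t _; rewrite sumEFin lee_fin sumr_ge0// => j _; rewrite mulr_ge0 ?sqr_ge0.
  - apply: emeasurable_sum => j; apply/measurable_EFinP; apply: measurable_funM => //.
    by apply: measurable_funX; exact: mlow.
  - by apply: measurable_funeM; apply/measurable_EFinP.
  move=> t _; rewrite sumEFin -EFinM lee_fin.
  under eq_bigr do rewrite /c -mulrA.
  rewrite -mulr_sumr -[leRHS]mulrA; apply: ler_wpM2l.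
    by rewrite mulr_ge0 ?powR_ge0.
  exact: low_sum.
rewrite ge0_integralZl_EFin//; last 2 first.
- by apply/measurable_EFinP.
- by rewrite mulr_ge0// mulr_ge0 ?powR_ge0.
rewrite uN -!EFinM lee_fin le_eqVlt; apply/orP; left; apply/eqP.
have -> : N `^ (q - 1) = N `^ (q - 2) * N.
  rewrite -{3}(powRr1 (ltW N0)) -powRD; first by congr (_ `^ _); ring.
  by apply/implyP => _; rewrite gt_eqF.
rewrite /interp_cst /D powRM ?(ltW N0)//.
by ring.
Qed.
End positive.

(** Monotone convergence in n.  The exponents are those of L^p to L^q: N is the p-th
power of the norm of u, and q - 1 = q / p.  The case N = 0 is separate because the
height of [low_part] degenerates there; then u vanishes almost everywhere. *)
Lemma kernel_op_Lp :
  (\int[m1]_r (`|kernel_op m2 k u r| `^ q)%:E <= (interp_cst * N `^ (q - 1))%:E)%E.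
Proof.
have mTu : measurable_fun [set: T1] (fun r => `|kernel_op m2 k u r|).
  by apply: measurableT_comp => //; exact: measurable_kernel_op.
have q0 : q != 0 by rewrite gt_eqF// -[q](subrK 2) addr_gt0.
have Nge0 : 0 <= N.
  by rewrite -lee_fin -uN; apply: integral_ge0 => t _; rewrite lee_fin powR_ge0.
have [N0|N0] := eqVneq N 0.
  have Tu0 r : kernel_op m2 k u r = 0.
    have mu0 : {ae m2, forall t, [set: T2] t -> `|u t| `^ p = 0}.
      have h : (\int[m2]_t `|(`|u t| `^ p)%:E| = 0)%E.
        under eq_integral do rewrite /= ger0_norm ?powR_ge0//.
        by rewrite uN N0.
      have mE : measurable_fun [set: T2] (fun t => (`|u t| `^ p)%:E).
        exact/measurable_EFinP.
      move/(ae_eq_integral_abs m2 measurableT mE) : h.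
      by apply: filterS => t /(_ I) [].
    rewrite /kernel_op /Rintegral (ae_eq_integral (cst 0%E))//; first by rewrite integral0.
    - apply/measurable_EFinP; apply: measurable_funM => //.
      exact: measurable_fun_pair2.
    - apply: filterS mu0 => t ht _ /=.
      by have /powR_eq0_eq0/normr0_eq0 -> := ht I; rewrite mul0r.
  under eq_integral do rewrite Tu0 normr0 powR0//.
  by rewrite integral0 lee_fin mulr_ge0 ?powR_ge0 ?interp_cst_ge0.
have {N0}N0 : 0 < N by rewrite lt_neqAle eq_sym N0.
pose h r := `|kernel_op m2 k u r|.
pose G (n : nat) r : \bar R :=
  (if ((2 ^+ n)^-1 < h r) && (h r <= 2 ^+ n) then h r `^ q else 0)%:E.
have G0 n r : [set: T1] r -> (0 <= G n r)%E.
  by move=> _; rewrite lee_fin; case: ifP => // _; exact: powR_ge0.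
have mG n : measurable_fun [set: T1] (G n).
  apply/measurable_EFinP; apply: measurable_fun_ifT => //.
    by apply: measurable_and; [exact: measurable_fun_ltr|exact: measurable_fun_ler].
  exact: (measurableT_comp (measurable_powR q)).
have ndG r : [set: T1] r -> nondecreasing_seq (G ^~ r).
  move=> _ a b ab; rewrite lee_fin.
  case: ifP => [/andP[h1 h2]|_]; last by case: ifP => // _; exact: powR_ge0.
  have ab2 : 2 ^+ a <= 2 ^+ b :> R by rewrite ler_eXn2l// ltr1n.
  rewrite ifT//; apply/andP; split; last exact: le_trans h2 ab2.
  by apply: le_lt_trans h1; rewrite lef_pV2// posrE exprn_gt0.
have cvG r : limn (G ^~ r) = (h r `^ q)%:E.
  apply: cvg_lim => //.
  have [h0|h0] := eqVneq (h r) 0.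
    rewrite (_ : G ^~ r = cst (h r `^ q)%:E); first exact: cvg_cst.
    apply/funext => n; rewrite /G h0 ifF ?powR0//.
    by rewrite ltNge invr_ge0 exprn_ge0.
  have {}h0 : 0 < h r by rewrite lt_neqAle eq_sym h0 normr_ge0.
  apply: cvg_near_cst; near=> n.
  rewrite /G ifT//; apply/andP; split; last first.
    apply: (@le_trans _ _ n%:R); first by near: n; exact: nbhs_infty_ger.
    by rewrite -natrX ler_nat ltnW// ltn_expl.
  rewrite invf_plt ?posrE ?exprn_gt0//.
  apply: (@lt_le_trans _ _ n%:R); first by near: n; exact: nbhs_infty_gtr.
  by rewrite -natrX ler_nat ltnW// ltn_expl.
rewrite [leLHS](_ : _ = \int[m1]_r limn (G ^~ r))%E; last first.
  by apply: eq_integral => r _; rewrite cvG.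
rewrite (monotone_convergence m1 measurableT mG G0 ndG).
apply: lime_le.
  apply: ereal_nondecreasing_is_cvgn => a b ab.
  by apply: (ge0_le_integral m1 measurableT) => //; [exact: G0|move=> r _; exact: ndG].
by apply: nearW => n; exact: (level_bound N0 n).
Unshelve. all: end_near. Qed.

End fixed_function.
End interpolation.

(** * Real components of the Laplace transform *)
Section components.
Context {R : realType}.
Let mu := @lebesgue_measure R.
Local Notation RT := (measurableTypeR R).
Implicit Types (f : R -> R[i]) (u v : R -> R).

Definition lap_part b u (x y : R) : R := \int[mu]_t (u t * damped b x y t).

(** For x > 0 this is the modulus of the Laplace transform of u + i v at x + i y
([laplace_lap_abs]).  Splitting the integrals beforehand makes it measurable in
(x, y) with no restriction on x. *)
Definition lap_abs u v (x y : R) : R :=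
  Num.sqrt ((lap_part true u x y + lap_part false v x y) ^+ 2 +
            (lap_part true v x y - lap_part false u x y) ^+ 2).

Lemma measurable_lap_part b u : measurable_fun [set: R] u ->
  measurable_fun [set: R * R] (fun z : R * R => lap_part b u z.1 z.2).
Proof.
move=> meas_u; apply: (measurable_Rintegral_section (T1 := (RT * RT)%type) (T2 := RT) mu
  (F := fun q : (R * R) * R => u q.2 * damped b q.1.1 q.1.2 q.2)).
apply: measurable_funM; last exact: measurable_damped.
exact: (measurableT_comp meas_u (@measurable_snd _ _ (RT * RT)%type RT)).
Qed.

Lemma measurable_lap_abs u v : measurable_fun [set: R] u ->
  measurable_fun [set: R] v ->
  measurable_fun [set: R * R] (fun z : R * R => lap_abs u v z.1 z.2).
Proof.
move=> meas_u mv; apply: measurableT_comp => //.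
  exact: continuous_measurable_fun (@sqrt_continuous R).
apply: measurable_funD; apply: measurable_funX.
  by apply: measurable_funD; exact: measurable_lap_part.
by apply: measurable_funB; exact: measurable_lap_part.
Qed.

Lemma integrable_lap_part b u e x y : measurable_fun [set: R] u -> e <= x ->
  mu.-integrable [set: R] (EFin \o (fun t => `|u t| * decay e t)) ->
  mu.-integrable [set: R] (EFin \o (fun t => u t * damped b x y t)).
Proof.
move=> meas_u ex iu; apply: (le_integrable measurableT _ _ iu).
  apply/measurable_EFinP; apply: measurable_funM => //.
  exact: (measurable_fun_pair2 (x, y) (measurable_damped b)).
move=> t _; rewrite /= lee_fin; apply: le_trans _ (ler_norm _).
by rewrite normrM ler_wpM2l// damped_le.
Qed.

Lemma laplace_lap_abs f (u v : R -> R) e x y : 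
  (forall t, Rpos t -> u t = complex.Re (f t)) ->
  (forall t, Rpos t -> v t = complex.Im (f t)) ->
  measurable_fun [set: R] u -> measurable_fun [set: R] v -> e <= x ->
  mu.-integrable [set: R] (EFin \o (fun t => `|u t| * decay e t)) ->
  mu.-integrable [set: R] (EFin \o (fun t => `|v t| * decay e t)) ->
  cabs (laplace f (x +i* y)%C) = lap_abs u v x y.
Proof.
move=> uf vf meas_u mv ex iu iv.
have iU b := integrable_lap_part b y meas_u ex iu.
have iV b := integrable_lap_part b y mv ex iv.
rewrite /lap_abs /lap_part -(RintegralD measurableT (iU true) (iV false)).
rewrite -(RintegralB measurableT (iV true) (iU false)).
rewrite /cabs /laplace /=.
congr (Num.sqrt (_ ^+ 2 + _ ^+ 2)).
- rewrite -Rintegral_indicM; apply: eq_Rintegral => t _.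
  rewrite /damped [\1_Rpos t]indicE; have [tp|tp] := boolP (t \in _); last first.
    by rewrite !mul0r !mulr0 addr0.
  rewrite !mul1r uf ?vf; [|exact: set_mem|exact: set_mem].
  case: (f t) => a b /=.
  have -> : - (x * t - y * 0) = - (x * t) by ring.
  have -> : - (x * 0 + y * t) = - (y * t) by ring.
  by rewrite cosN sinN; ring.
- rewrite -Rintegral_indicM; apply: eq_Rintegral => t _.
  rewrite /damped [\1_Rpos t]indicE; have [tp|tp] := boolP (t \in _); last first.
    by rewrite !mul0r !mulr0 subr0.
  rewrite !mul1r uf ?vf; [|exact: set_mem|exact: set_mem].
  case: (f t) => a b /=.
  have -> : - (x * t - y * 0) = - (x * t) by ring.
  have -> : - (x * 0 + y * t) = - (y * t) by ring.
  by rewrite cosN sinN; ring.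
Qed.

Lemma lap_abs_le u v x y : lap_abs u v x y <=
  `|lap_part true u x y| + `|lap_part false v x y| +
  (`|lap_part true v x y| + `|lap_part false u x y|).
Proof.
have sqrt_le (a b : R) : Num.sqrt (a ^+ 2 + b ^+ 2) <= `|a| + `|b|.
  rewrite -[leRHS]ger0_norm ?addr_ge0// -sqrtr_sqr ler_sqrt ?sqr_ge0//.
  rewrite sqrrD !real_normK ?num_real// lerD2r.
  by rewrite lerDl mulrn_wge0// mulr_ge0.
apply: le_trans (sqrt_le _ _) _; apply: lerD; first exact: ler_normD.
exact: ler_normB.
Qed.

Lemma lap_part_le b u e x y : measurable_fun [set: R] u -> e <= x -> 0 <= e ->
  mu.-integrable [set: R] (EFin \o u) -> `|lap_part b u x y| <= \int[mu]_t `|u t|.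
Proof.
move=> meas_u ex e0 iu.
have iuw : mu.-integrable [set: R] (EFin \o (fun t => u t * damped b x y t)).
  apply: (le_integrable measurableT _ _ iu).
    apply/measurable_EFinP; apply: measurable_funM => //.
    exact: (measurable_fun_pair2 (x, y) (measurable_damped b)).
  move=> t _; rewrite /= lee_fin normrM ler_piMr//.
  by apply: le_trans (damped_le b y t ex) _; case/andP: (decay01 t e0).
apply: le_trans (le_normr_Rintegral measurableT iuw) _.
apply: le_Rintegral => //; [exact: integrable_norm iuw|exact: integrable_norm iu|].
move=> t _; rewrite normrM ler_piMr//.
by apply: le_trans (damped_le b y t ex) _; case/andP: (decay01 t e0).
Qed.

End components.

(** * Bounds along a measurable choice of angles *)
Section linearized_bound.
Context {R : realType}.
Let mu := @lebesgue_measure R.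
Local Notation RT := (measurableTypeR R).

Section strong_type.
Variables (x y : R -> R) (E : set R) (e : R).
Hypothesis mx : measurable_fun [set: R] x.
Hypothesis my : measurable_fun [set: R] y.
Hypothesis mE : measurable E.
Hypothesis muE : (mu E < +oo)%E.
Hypothesis e0 : 0 < e.
Hypothesis xe : forall r, E r -> e <= x r.
Hypothesis dist_ge : forall r s, E r -> E s -> (r - s) ^+ 2 <= refl_dist2 x y r s.

Local Notation T b u := (kernel_op (T1 := RT) (T2 := RT) mu (lap_kernel x y E b) u).

Lemma lap_kernel_L2 b (u : R -> R) : measurable_fun [set: R] u ->
  (\int[mu]_t (u t ^+ 2)%:E < +oo)%E ->
  (\int[mu]_r (T b u r ^+ 2)%:E <= (16 * pi)%:E * \int[mu]_t (u t ^+ 2)%:E)%E.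
Proof.
move=> meas_u u2.
have mk := measurable_lap_kernel mx my mE b.
have iw := integrable_decay e0.
have w01 t := decay01 t (ltW e0).
have kw := lap_kernel_le_decay y e0 xe b.
have kvw := lap_kernel_le y xe b.
have iE := integrable_indic_finite mE muE.
have E01 (r : R) := indic01 R E r.
have iu2 : mu.-integrable [set: R] (EFin \o (fun t => u t ^+ 2)).
  apply/integrableP; split; first by apply/measurable_EFinP; exact: measurable_funX.
  by under eq_integral do rewrite /= ger0_norm ?sqr_ge0//.
have iu2' : mu.-integrable [set: R] (EFin \o (fun t => `|u t| `^ 2)).
  by apply: eq_integrable iu2 => // t _ /=; rewrite powR_mulrn// real_normK ?num_real.
have iuw : mu.-integrable [set: R] (EFin \o (fun t => `|u t| * decay e t)).
  by apply: (integrable_powR_decayM iw w01 _ iu2') => //; rewrite ler1n.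
have TB := kernel_op_le_supp (T1 := RT) (T2 := RT) mk kw meas_u iuw kvw.
have mT := measurable_kernel_op (T1 := RT) (T2 := RT) mu mk meas_u.
have iT2 := integrable_sqr_supp (T1 := RT) iE E01 mT TB.
have K0 : 0 < 16 * pi :> R by rewrite mulr_gt0// pi_gt0.
have := kernel_op_L2 (T1 := RT) (T2 := RT) mk iw w01 kw meas_u iuw iE E01 kvw K0
  (fun G M mG GM => lap_adj_energy mx my mE muE e0 xe dist_ge b mG GM) iu2.
rewrite -lee_fin EFinM /Rintegral fineK; last exact/integrable_fin_num/iT2.
by rewrite fineK//; exact/integrable_fin_num/iu2.
Qed.

Definition strong_cst (p : R) : R :=
  if p == 2 then 16 * pi else interp_cst (16 * pi) p.

Lemma strong_cst_ge0 p : 1 < p <= 2 -> 0 <= strong_cst p.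
Proof.
move=> /andP[p1 p2]; rewrite /strong_cst; case: eqVneq => [_|p2'].
  by rewrite mulr_ge0// pi_ge0.
by apply: interp_cst_ge0; rewrite ?mulr_ge0 ?pi_ge0// p1 lt_neqAle p2' p2.
Qed.

Lemma lap_kernel_Lp b (p N : R) (u : R -> R) : 1 < p <= 2 ->
  measurable_fun [set: R] u -> (\int[mu]_t (`|u t| `^ p)%:E = N%:E)%E ->
  (\int[mu]_r (`|T b u r| `^ (conj_exp p))%:E <=
   (strong_cst p * N `^ (conj_exp p - 1))%:E)%E.
Proof.
move=> /andP[p1 p2] meas_u uN; rewrite /strong_cst; case: eqVneq => [p2E|p2N].
  have q2 : conj_exp p = 2 by rewrite /conj_exp p2E; field.
  have u2E : (\int[mu]_t (u t ^+ 2)%:E = N%:E)%E.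
    rewrite -uN p2E; apply: eq_integral => t _.
    by rewrite powR_mulrn// real_normK ?num_real.
  have N0 : 0 <= N.
    by rewrite -lee_fin -u2E; apply: integral_ge0 => t _; rewrite lee_fin sqr_ge0.
  rewrite q2 (_ : 2 - 1 = 1); last by ring.
  rewrite powRr1// EFinM -u2E.
  have -> : (\int[mu]_r (`|T b u r| `^ 2)%:E = \int[mu]_r (T b u r ^+ 2)%:E)%E.
    by apply: eq_integral => r _; rewrite powR_mulrn// real_normK ?num_real.
  by apply: lap_kernel_L2 => //; rewrite u2E ltry.
apply: (kernel_op_Lp (T1 := RT) (T2 := RT) (w := decay e)) => //.
- exact: measurable_lap_kernel.
- exact: integrable_decay.
- by move=> t; exact: decay01 (ltW e0).
- exact: lap_kernel_le_decay.
- by rewrite mulr_ge0// pi_ge0.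
- by rewrite p1 lt_neqAle p2N p2.
- exact: lap_kernel_L2.
Qed.

End strong_type.

Lemma powR_sum4 (q a b c d : R) : 0 <= q -> 0 <= a -> 0 <= b -> 0 <= c -> 0 <= d ->
  (a + b + (c + d)) `^ q <= 4 `^ q * (a `^ q + b `^ q + (c `^ q + d `^ q)).
Proof.
move=> q0 a0 b0 c0 d0.
pose m := Num.max (Num.max a b) (Num.max c d).
have [ma mb mc md] : [/\ a <= m, b <= m, c <= m & d <= m].
  split; rewrite /m le_max; apply/orP; [left|left|right|right];
    by rewrite le_max; apply/orP; auto.
have m0 : 0 <= m by exact: le_trans ma.
apply: (@le_trans _ _ ((4 * m) `^ q)).
  apply: ge0_ler_powR; rewrite ?nnegrE ?addr_ge0 ?mulr_ge0//; lra.
rewrite powRM//; apply: ler_wpM2l; first exact: powR_ge0.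
have := powR_ge0 a q; have := powR_ge0 b q.
have := powR_ge0 c q; have := powR_ge0 d q.
by rewrite /m /Order.max; repeat case: ifP => _; lra.
Qed.

(** On `[a, b] the curve rho exp(i th(rho)) stays at distance at least a c from the
imaginary axis.  The inequality (r - s)^2 <= |z(r) + conj z(s)|^2 reduces to
cos (th(r) + th(s)) >= -1. *)
Lemma arc_linearized_bound (p A a b c : R) (u v th : R -> R) : 1 < p <= 2 ->
  measurable_fun [set: R] u -> measurable_fun [set: R] v ->
  (\int[mu]_t (`|u t| `^ p)%:E <= A%:E)%E ->
  (\int[mu]_t (`|v t| `^ p)%:E <= A%:E)%E ->
  measurable_fun [set: R] th -> 0 < c -> (forall r, c <= cos (th r)) -> 0 < a ->
  (\int[mu]_(r in `[a, b]) (lap_abs u v (r * cos (th r)) (r * sin (th r))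
      `^ (conj_exp p))%:E <=
   (4 `^ (conj_exp p) * (4 * strong_cst p) * A `^ (conj_exp p - 1))%:E)%E.
Proof.
move=> p12 meas_u mv uA vA mth c0 cth a0.
have [p1 p2] := andP p12.
pose q := conj_exp p.
have q1 : 0 <= q - 1.
  rewrite /q /conj_exp (_ : _ - _ = (p - 1)^-1); last first.
    by field; rewrite gt_eqF// subr_gt0.
  by rewrite invr_ge0 subr_ge0 ltW.
have q0 : 0 <= q by rewrite -[q](subrK 1) addr_ge0.
pose E : set R := `[a, b]%classic.
have mE : measurable E by exact: measurable_itv.
have muE : (mu E < +oo)%E.
  rewrite /mu /E lebesgue_measure_itv; case: ifP => _; last by rewrite ltry.
  by rewrite -EFinB ltry.
pose x r := r * cos (th r); pose y r := r * sin (th r).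
have mcos : measurable_fun [set: R] (fun r => cos (th r)).
  by apply: (measurableT_comp _ mth); exact: (measurable_osc true).
have msin : measurable_fun [set: R] (fun r => sin (th r)).
  by apply: (measurableT_comp _ mth); exact: (measurable_osc false).
have mx : measurable_fun [set: R] x by exact: measurable_funM.
have my : measurable_fun [set: R] y by exact: measurable_funM.
have e0 : 0 < a * c by rewrite mulr_gt0.
have Ea r : E r -> a <= r by rewrite /E /= in_itv/= => /andP[].
have xe r : E r -> a * c <= x r.
  by move=> /Ea ar; apply: ler_pM => //; exact: ltW.
have dist_ge r s : E r -> E s -> (r - s) ^+ 2 <= refl_dist2 x y r s.
  move=> /Ea ar /Ea as'; rewrite /refl_dist2 /x /y.
  have := cos_geN1 (th r + th s); rewrite cosD.
  have := cos2Dsin2 (th r); have := cos2Dsin2 (th s).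
  set C := cos (th r); set S := sin (th r); set C' := cos (th s); set S' := sin (th s).
  move=> h1 h2 h3.
  have -> : (r * C + s * C') ^+ 2 + (r * S - s * S') ^+ 2 =
     r ^+ 2 * (C ^+ 2 + S ^+ 2) + s ^+ 2 * (C' ^+ 2 + S' ^+ 2) +
     2 * (r * s) * (C * C' - S * S') by ring.
  rewrite h1 h2.
  have rs : 0 <= r * s by rewrite mulr_ge0// (le_trans (ltW a0)).
  nra.
pose T b u := kernel_op (T1 := RT) (T2 := RT) mu (lap_kernel x y E b) u.
have TE b' w r : E r -> T b' w r = lap_part b' w (x r) (y r).
  move=> Er; rewrite /T /kernel_op /lap_part; apply: eq_Rintegral => t _.
  by rewrite /lap_kernel /= indicE mem_set// mul1r.
have mT b' (w : R -> R) : measurable_fun [set: R] w -> measurable_fun [set: R] (T b' w).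
  move=> mw; apply: (measurable_kernel_op (T1 := RT) (T2 := RT)) => //.
  exact: measurable_lap_kernel.
have mTq b' (w : R -> R) : measurable_fun [set: R] w ->
    measurable_fun [set: R] (fun r => (`|T b' w r| `^ q)%:E).
  move=> mw; apply/measurable_EFinP; apply: (measurableT_comp (measurable_powR q)).
  by apply: measurableT_comp => //; exact: mT.
have Tbound b' (w : R -> R) : measurable_fun [set: R] w ->
    (\int[mu]_t (`|w t| `^ p)%:E <= A%:E)%E ->
    (\int[mu]_r (`|T b' w r| `^ q)%:E <= (strong_cst p * A `^ (q - 1))%:E)%E.
  move=> mw wA; have w0 : (0 <= \int[mu]_t (`|w t| `^ p)%:E)%E.
    by apply: integral_ge0 => t _; rewrite lee_fin powR_ge0.
  have wfin : (\int[mu]_t (`|w t| `^ p)%:E)%E \is a fin_num.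
    by rewrite ge0_fin_numE// (le_lt_trans wA)// ltry.
  apply: le_trans (lap_kernel_Lp mx my mE muE e0 xe dist_ge b' p12 mw
    (esym (fineK wfin))) _.
  rewrite lee_fin; apply: ler_wpM2l; first exact: strong_cst_ge0.
  have fA : fine (\int[mu]_t (`|w t| `^ p)%:E)%E <= A by rewrite -lee_fin fineK.
  by apply: ge0_ler_powR => //; rewrite nnegrE ?fine_ge0// (le_trans _ fA)// fine_ge0.
clearbody T.
apply: (@le_trans _ _ (\int[mu]_r ((4 `^ q)%:E *
   ((`|T true u r| `^ q)%:E + (`|T false v r| `^ q)%:E +
    ((`|T true v r| `^ q)%:E + (`|T false u r| `^ q)%:E))))%E).
  rewrite -integral_indicM.
  have mS : measurable_fun [set: R] (fun r =>
    ((`|T true u r| `^ q)%:E + (`|T false v r| `^ q)%:E +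
    ((`|T true v r| `^ q)%:E + (`|T false u r| `^ q)%:E))%E).
    by apply: emeasurable_funD; apply: emeasurable_funD; exact: mTq.
  apply: (ge0_le_integral mu measurableT).
  - by move=> r _; rewrite lee_fin mulr_ge0 ?powR_ge0.
  - apply/measurable_EFinP; apply: measurable_funM; first exact: measurable_indic.
    apply: (measurableT_comp (measurable_powR q)).
    exact: (measurableT_comp (measurable_lap_abs meas_u mv) (measurable_fun_pair mx my)).
  - exact: measurable_funeM.
  move=> r _; rewrite -!EFinD -EFinM lee_fin indicE.
  have [Er|Er] := boolP (r \in E); last first.
    by rewrite mul0r mulr_ge0 ?powR_ge0// !addr_ge0 ?powR_ge0.
  rewrite mul1r; apply: le_trans _ (powR_sum4 q0 _ _ _ _) => //.
  apply: ge0_ler_powR => //; rewrite ?nnegrE ?addr_ge0 ?sqrtr_ge0//.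
  have Er' := set_mem Er; rewrite !TE//.
  exact: lap_abs_le.
have p0 (w : R -> R) (b' : bool) (r : R) : [set: R] r -> (0 <= (`|T b' w r| `^ q)%:E)%E.
  by rewrite lee_fin powR_ge0.
have p1' r : [set: R] r -> (0 <= (`|T true u r| `^ q)%:E + (`|T false v r| `^ q)%:E)%E.
  by move=> ?; apply: adde_ge0; exact: p0.
have p2' r : [set: R] r -> (0 <= (`|T true v r| `^ q)%:E + (`|T false u r| `^ q)%:E)%E.
  by move=> ?; apply: adde_ge0; exact: p0.
have m1' := emeasurable_funD (mTq true u meas_u) (mTq false v mv).
have m2' := emeasurable_funD (mTq true v mv) (mTq false u meas_u).
have p3' r : [set: R] r -> (0 <= (`|T true u r| `^ q)%:E + (`|T false v r| `^ q)%:E +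
    ((`|T true v r| `^ q)%:E + (`|T false u r| `^ q)%:E))%E.
  by move=> ?; apply: adde_ge0; [exact: p1'|exact: p2'].
have m3' := emeasurable_funD m1' m2'.
rewrite (ge0_integralZl_EFin mu measurableT p3' m3' (powR_ge0 4 q)).
rewrite (ge0_integralD mu measurableT p1' m1' p2' m2').
rewrite (ge0_integralD mu measurableT
  (p0 u true) (mTq true u meas_u) (p0 v false) (mTq false v mv)).
rewrite (ge0_integralD mu measurableT
  (p0 v true) (mTq true v mv) (p0 u false) (mTq false u meas_u)).
rewrite -!mulrA EFinM; apply: lee_wpmul2l; first by rewrite lee_fin powR_ge0.
have -> : 4 * (strong_cst p * A `^ (q - 1)) =
  strong_cst p * A `^ (q - 1) + strong_cst p * A `^ (q - 1) +
  (strong_cst p * A `^ (q - 1) + strong_cst p * A `^ (q - 1)) by ring.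
by rewrite !EFinD; apply: leeD; apply: leeD; exact: Tbound.
Qed.

End linearized_bound.

(** * The angular maximal function as a monotone limit *)
Section angular.
Context {R : realType}.
Let mu := @lebesgue_measure R.
Local Notation RT := (measurableTypeR R).
Variables (u v : R -> R).
Hypothesis meas_u : measurable_fun [set: R] u.
Hypothesis meas_v : measurable_fun [set: R] v.
Hypothesis iu : forall e, 0 < e ->
  mu.-integrable [set: R] (EFin \o (fun t => `|u t| * decay e t)).
Hypothesis iv : forall e, 0 < e ->
  mu.-integrable [set: R] (EFin \o (fun t => `|v t| * decay e t)).

(** Near th0 the real part rho cos th stays above half of its value at th0, which
gives an integrable majorant for continuity under the integral. *)
Lemma continuous_lap_part_arc b (g : R -> R) (rho th0 : R) :
  measurable_fun [set: R] g -> (forall e, 0 < e ->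
    mu.-integrable [set: R] (EFin \o (fun t => `|g t| * decay e t))) ->
  0 < rho -> 0 < cos th0 ->
  {for th0, continuous (fun th => lap_part b g (rho * cos th) (rho * sin th))}.
Proof.
move=> mg ig rho0 cos0.
have c20 : 0 < cos th0 / 2 by rewrite divr_gt0.
have := @continuous_cos R th0.
move=> /cvgrPdist_lt /(_ _ c20) /nbhs_ballP[d /= d0 dP].
have near_cos th : `]th0 - d, th0 + d[%classic th -> cos th0 / 2 <= cos th.
  rewrite /= in_itv /= => /andP[h1 h2].
  have : ball th0 d th by rewrite /ball /= ltr_distlC h1 h2.
  by move=> /dP; rewrite ltr_norml => /andP[_]; lra.
pose e := rho * (cos th0 / 2).
have e0 : 0 < e by rewrite mulr_gt0.
have ex th : `]th0 - d, th0 + d[%classic th -> e <= rho * cos th.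
  by move=> /near_cos h; apply: ler_wpM2l => //; exact: ltW.
apply: (@continuity_under_integral R _ RT mu
  (fun th t => g t * damped b (rho * cos th) (rho * sin th) t) [set: R] measurableT
  (th0 - d) (th0 + d) _ _ (fun t => `|g t| * decay e t) (ig _ e0)).
- move=> th /ex eth; exact: integrable_lap_part mg eth (ig _ e0).
- apply: aeW => t _ th _.
  apply: cvgM; first exact: cvg_cst.
  apply: cvgM; first exact: cvg_cst.
  have ccos : (fun th => rho * cos th) @ th --> rho * cos th.
    by apply: cvgM; [exact: cvg_cst|exact: continuous_cos].
  have csin : (fun th => rho * sin th) @ th --> rho * sin th.
    by apply: cvgM; [exact: cvg_cst|exact: continuous_sin].
  apply: cvgM.
    apply: (@cvg_comp _ _ _ (fun th => rho * cos th) (fun x => expR (- (x * t))) _ _ _ ccos).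
    apply: (@cvg_comp _ _ _ (fun x => - (x * t)) expR).
      by apply: cvgN; apply: cvgM; [exact: cvg_id|exact: cvg_cst].
    exact: continuous_expR.
  apply: (@cvg_comp _ _ _ (fun th => rho * sin th) (fun y => osc b (y * t)) _ _ _ csin).
  apply: (@cvg_comp _ _ _ (fun y => y * t) (osc b)).
    by apply: cvgM; [exact: cvg_id|exact: cvg_cst].
  exact: continuous_osc.
- move=> th /ex eth; apply: aeW => t _.
  by rewrite normrM ler_wpM2l// damped_le.
- by rewrite inE /= in_itv /= ltrBlDr ltrDl d0.
Qed.

Definition arc_abs (rho th : R) : R := lap_abs u v (rho * cos th) (rho * sin th).

Lemma continuous_arc_abs (rho th0 : R) : 0 < rho -> 0 < cos th0 ->
  {for th0, continuous (arc_abs rho)}.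
Proof.
move=> rho0 cos0.
have cp b g mg ig := @continuous_lap_part_arc b g rho th0 mg ig rho0 cos0.
have sq (F : R -> R) : {for th0, continuous F} -> (fun th => F th ^+ 2) @ th0 --> F th0 ^+ 2.
  move=> cF; exact: (@cvg_comp _ _ _ F (fun x => x ^+ 2) _ _ _ cF (@exprn_continuous _ 2 _)).
rewrite /continuous_at /arc_abs /lap_abs.
apply: (@cvg_comp _ _ _ (fun th => _ ^+ 2 + _ ^+ 2) Num.sqrt _ _ _ _ (@sqrt_continuous R _)).
apply: cvgD.
  by apply: (sq (fun th => _ + _)); apply: cvgD; exact: cp.
by apply: (sq (fun th => _ - _)); apply: cvgB; exact: cp.
Qed.

Lemma cos_gt0_arc (th : R) : `|th| < pi / 2 -> 0 < cos th.
Proof. by rewrite ltr_norml => h; exact: cos_gt0_pihalf. Qed.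

(** A sequence dense in (- pi / 2, pi / 2): the rationals of that interval, with the
other indices sent to 0. *)
Definition angle (j : nat) : R :=
  let q := ratr (odflt 0 (unpickle j : option rat)) in
  if `|q| < pi / 2 then q else 0.

Lemma angle_range j : `|angle j| < pi / 2.
Proof. by rewrite /angle; case: ifP => // _; rewrite normr0 divr_gt0// pi_gt0. Qed.

Lemma angle_dense (th d : R) : `|th| < pi / 2 -> 0 < d ->
  exists j, `|th - angle j| < d.
Proof.
rewrite ltr_norml => /andP[th1 th2] d0.
have : Num.max (th - d) (- (pi / 2)) < th by rewrite gt_max th1 andbT ltrBlDr ltrDl.
move=> /rat_in_itvoo[q]; rewrite in_itv /= gt_max => /andP[/andP[q1 q2] q3].
exists (pickle q); rewrite /angle pickleK /= ifT.
  rewrite ger0_norm ?subr_ge0 ?ltW//; lra.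
by rewrite ltr_norml q2 (lt_trans q3).
Qed.

(** The angle among 0, angle 0, ..., angle (J - 1) at which the modulus is largest; a
new angle is taken only if it is strictly better, which keeps the choice
measurable. *)
Fixpoint best_angle (J : nat) (rho : R) : R :=
  if J is J'.+1 then
    if arc_abs rho (best_angle J' rho) < arc_abs rho (angle J') then angle J'
    else best_angle J' rho
  else 0.

Lemma best_angle_range J rho : `|best_angle J rho| < pi / 2.
Proof.
elim: J => [|J IHJ] /=; first by rewrite normr0 divr_gt0// pi_gt0.
by case: ifP => // _; exact: angle_range.
Qed.

(** Only finitely many angles are used for a given J, so the lower bound is uniform in
the radius. *)
Lemma best_angle_cos J : exists2 c : R, 0 < c & forall rho, c <= cos (best_angle J rho).
Proof.
elim: J => [|J [c c0 cP]].
  by exists 1 => // rho; rewrite /= cos0.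
exists (Num.min c (cos (angle J))).
  by rewrite lt_min c0 cos_gt0_arc// angle_range.
by move=> rho /=; case: ifP => _; rewrite ge_min ?lexx ?orbT// cP.
Qed.

Lemma measurable_arc_abs (th : R -> R) : measurable_fun [set: R] th ->
  measurable_fun [set: R] (fun rho => arc_abs rho (th rho)).
Proof.
move=> mth; have mc : measurable_fun [set: R] (fun r => cos (th r)).
  by apply: (measurableT_comp _ mth); exact: (measurable_osc true).
have ms : measurable_fun [set: R] (fun r => sin (th r)).
  by apply: (measurableT_comp _ mth); exact: (measurable_osc false).
have mx : measurable_fun [set: R] (fun r => r * cos (th r)) by exact: measurable_funM.
have my : measurable_fun [set: R] (fun r => r * sin (th r)) by exact: measurable_funM.
exact: (measurableT_comp (measurable_lap_abs meas_u meas_v) (measurable_fun_pair mx my)).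
Qed.

Lemma measurable_best_angle J : measurable_fun [set: R] (best_angle J).
Proof.
elim: J => [|J IHJ]; first exact: measurable_cst.
apply: measurable_fun_ifT => //.
by apply: measurable_fun_ltr; apply: measurable_arc_abs => //; exact: measurable_cst.
Qed.

Lemma arc_abs_best_nd rho : {homo (fun J => arc_abs rho (best_angle J rho)) :
  i j / (i <= j)%N >-> i <= j}.
Proof.
apply: homo_leq => [x|y x z|J]; [exact: lexx|exact: le_trans|].
by rewrite /=; case: ifP => [/ltW//|_]; exact: lexx.
Qed.

Lemma arc_abs_angle_best rho j :
  arc_abs rho (angle j) <= arc_abs rho (best_angle j.+1 rho).
Proof. by rewrite /=; case: ltP. Qed.

(** By continuity in the angle, a value that exceeded the supremum over the dense
sequence would do so at some member of the sequence. *)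
Lemma angular_max_best (f : R -> R[i]) (rho : R) :
  (forall t, Rpos t -> u t = complex.Re (f t)) ->
  (forall t, Rpos t -> v t = complex.Im (f t)) -> 0 < rho ->
  angular_max_laplace f rho =
  ereal_sup (range (fun J => (arc_abs rho (best_angle J rho))%:E)).
Proof.
move=> uf vf rho0.
have arcE th : `|th| < pi / 2 ->
    cabs (laplace f (rho%:C * cexp (0 +i* th))%C) = arc_abs rho th.
  move=> /cos_gt0_arc c0; have e0 : 0 < rho * cos th by rewrite mulr_gt0.
  rewrite (_ : (_ * _)%C = ((rho * cos th) +i* (rho * sin th))%C); last first.
    rewrite /cexp /= expR0 !mul1r.
    by apply/eqP; rewrite eq_complex /= !mul0r subr0 addr0 !eqxx.
  exact: (laplace_lap_abs _ uf vf meas_u meas_v (lexx _) (iu e0) (iv e0)).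
apply/eqP; rewrite eq_le; apply/andP; split.
  apply: ge_ereal_sup => _ [th thr <-]; rewrite (arcE th thr).
  rewrite leNgt; apply/negP => hlt.
  have [s hs hs2] : exists2 s : R, s < arc_abs rho th &
      forall J, arc_abs rho (best_angle J rho) <= s.
    have sup_ge J : ((arc_abs rho (best_angle J rho))%:E <=
        ereal_sup (range (fun J => (arc_abs rho (best_angle J rho))%:E)))%E.
      by apply: ereal_sup_ubound; exists J.
    move: hlt sup_ge; case: ereal_sup => [s||] //=.
    - by rewrite lte_fin => h1 h2; exists s => // J; rewrite -lee_fin.
    - by move=> _ /(_ 0%N).
  have := continuous_arc_abs rho0 (cos_gt0_arc thr).
  have d0 : 0 < arc_abs rho th - s by rewrite subr_gt0.
  move=> /cvgrPdist_lt /(_ _ d0) /nbhs_ballP[d /= d1 dP].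
  have [j jd] := angle_dense thr d1.
  have := dP _ jd; rewrite ltr_norml => /andP[_].
  have := hs2 j.+1; have := arc_abs_angle_best rho j; lra.
apply: ge_ereal_sup => _ [J _ <-]; apply: ereal_sup_ubound.
exists (best_angle J rho); first exact: best_angle_range.
by rewrite arcE//; exact: best_angle_range.
Qed.

End angular.

(** * Norm estimates *)
Section final.
Context {R : realType}.
Let mu := @lebesgue_measure R.
Local Notation RT := (measurableTypeR R).
Implicit Types (f : R -> R[i]).

Definition re_part f : R -> R := (fun t => complex.Re (f t)) \_ Rpos.
Definition im_part f : R -> R := (fun t => complex.Im (f t)) \_ Rpos.

Lemma measurable_re_part p f : Lp_pos p f -> measurable_fun [set: R] (re_part f).
Proof. by case=> mre _ _; apply/(measurable_restrictT _ measurable_Rpos). Qed.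

Lemma measurable_im_part p f : Lp_pos p f -> measurable_fun [set: R] (im_part f).
Proof. by case=> _ mim _; apply/(measurable_restrictT _ measurable_Rpos). Qed.

Lemma cabs_parts f t : ((fun t => (cabs (f t))%:E) \_ Rpos) t =
  (Num.sqrt (re_part f t ^+ 2 + im_part f t ^+ 2))%:E.
Proof.
rewrite /re_part /im_part !patchE; case: (t \in Rpos).
  by rewrite /cabs; case: (f t).
by rewrite expr0n addr0 sqrtr0.
Qed.

Lemma re_part_le f t :
  `|re_part f t| <= Num.sqrt (re_part f t ^+ 2 + im_part f t ^+ 2).
Proof. by rewrite -sqrtr_sqr ler_sqrt ?addr_ge0 ?sqr_ge0// lerDl sqr_ge0. Qed.

Lemma im_part_le f t :
  `|im_part f t| <= Num.sqrt (re_part f t ^+ 2 + im_part f t ^+ 2).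
Proof. by rewrite -sqrtr_sqr ler_sqrt ?addr_ge0 ?sqr_ge0// lerDr sqr_ge0. Qed.

(** The p-th power of the L^p norm of f, with the modulus of f written through its
extended real and imaginary parts. *)
Definition Lp_mass (p : R) f : \bar R :=
  (\int[mu]_t (Num.sqrt (re_part f t ^+ 2 + im_part f t ^+ 2) `^ p)%:E)%E.

Lemma Lnorm_posE p f :
  Lnorm_pos p%:E (fun t => (cabs (f t))%:E) = (Lp_mass p f `^ p^-1)%E.
Proof.
rewrite /Lnorm_pos unlock; congr (_ `^ _)%E.
apply: eq_integral => t _; rewrite cabs_parts/= ger0_norm//.
Qed.

Section parts.
Variables (p : R) (f : R -> R[i]).
Hypothesis p1 : 1 <= p.
Hypothesis fLp : Lp_pos p%:E f.

Let mu_re := measurable_re_part fLp.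
Let mu_im := measurable_im_part fLp.

Let msq : measurable_fun [set: R]
  (fun t => Num.sqrt (re_part f t ^+ 2 + im_part f t ^+ 2) `^ p).
Proof.
apply: (measurableT_comp (measurable_powR p)).
apply: measurableT_comp.
  exact: continuous_measurable_fun (@sqrt_continuous R).
by apply: measurable_funD; exact: measurable_funX.
Qed.

Lemma Lp_mass_ge0 : (0 <= Lp_mass p f)%E.
Proof. by apply: integral_ge0 => t _; rewrite lee_fin powR_ge0. Qed.

Lemma Lp_mass_fin : Lp_mass p f \is a fin_num.
Proof.
rewrite ge0_fin_numE ?Lp_mass_ge0//.
have [_ _] := fLp; rewrite Lnorm_posE; apply: lty_poweRy.
by rewrite invr_neq0// gt_eqF// (lt_le_trans _ p1).
Qed.

Lemma part_mass_le (g : R -> R) : measurable_fun [set: R] g ->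
  (forall t, `|g t| <= Num.sqrt (re_part f t ^+ 2 + im_part f t ^+ 2)) ->
  (\int[mu]_t (`|g t| `^ p)%:E <= Lp_mass p f)%E.
Proof.
move=> mg gle; apply: (ge0_le_integral mu measurableT).
- by move=> t _; rewrite lee_fin powR_ge0.
- apply/measurable_EFinP; apply: (measurableT_comp (measurable_powR p)).
  exact: measurableT_comp.
- exact/measurable_EFinP.
move=> t _; rewrite lee_fin; apply: ge0_ler_powR; rewrite ?nnegrE ?sqrtr_ge0//.
exact: le_trans p1.
Qed.

Lemma part_integrable (g : R -> R) : measurable_fun [set: R] g ->
  (forall t, `|g t| <= Num.sqrt (re_part f t ^+ 2 + im_part f t ^+ 2)) ->
  mu.-integrable [set: R] (EFin \o (fun t => `|g t| `^ p)).
Proof.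
move=> mg gle; apply/integrableP; split.
  apply/measurable_EFinP; apply: (measurableT_comp (measurable_powR p)).
  exact: measurableT_comp.
under eq_integral do rewrite /= ger0_norm ?powR_ge0//.
apply: le_lt_trans (part_mass_le mg gle) _.
by rewrite -ge0_fin_numE ?Lp_mass_ge0// Lp_mass_fin.
Qed.

Lemma part_decay_integrable (g : R -> R) e : measurable_fun [set: R] g ->
  (forall t, `|g t| <= Num.sqrt (re_part f t ^+ 2 + im_part f t ^+ 2)) -> 0 < e ->
  mu.-integrable [set: R] (EFin \o (fun t => `|g t| * decay e t)).
Proof.
move=> mg gle e0; have w01 t := decay01 t (ltW e0).
exact: (integrable_powR_decayM (integrable_decay e0) w01 p1
  (part_integrable mg gle) mg (fun t => lexx _)).
Qed.

End parts.

Lemma re_partE f t : Rpos t -> re_part f t = complex.Re (f t).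
Proof. by move=> tp; rewrite /re_part patchE mem_set. Qed.

Lemma im_partE f t : Rpos t -> im_part f t = complex.Im (f t).
Proof. by move=> tp; rewrite /im_part patchE mem_set. Qed.

(** The factor 4 counts the cosine and sine integrals of the real and imaginary parts
of f. *)
Lemma angular_max_L1 f : Lp_pos 1%:E f ->
  (Lnorm_pos +oo (angular_max_laplace f) <=
   4%:E * Lnorm_pos 1%:E (fun t => (cabs (f t))%:E))%E.
Proof.
move=> f1; have le11 : 1 <= 1 :> R by [].
have mre := measurable_re_part f1; have mim := measurable_im_part f1.
rewrite Lnorm_posE invr1 poweRe1 ?Lp_mass_ge0//.
have Mfin := Lp_mass_fin le11 f1.
have i1 (g : R -> R) : measurable_fun [set: R] g ->
    (forall t, `|g t| <= Num.sqrt (re_part f t ^+ 2 + im_part f t ^+ 2)) ->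
    mu.-integrable [set: R] (EFin \o g) /\ \int[mu]_t `|g t| <= fine (Lp_mass 1 f).
  move=> mg gle.
  have ig : mu.-integrable [set: R] (EFin \o (fun t => `|g t|)).
    apply: eq_integrable (part_integrable le11 f1 mg gle) => // t _ /=.
    by rewrite powRr1.
  split.
    apply: (le_integrable measurableT _ _ ig); first exact/measurable_EFinP.
    by move=> t _; rewrite /= normr_id.
  rewrite /Rintegral fine_le//; first exact/integrable_fin_num/ig.
  apply: le_trans _ (part_mass_le le11 f1 mg gle).
  by under [leRHS]eq_integral do rewrite powRr1//.
have [ire nre] := i1 _ mre (re_part_le f).
have [iim nim] := i1 _ mim (im_part_le f).
rewrite -(fineK Mfin) -EFinM /Lnorm_pos unlock.
case: ifPn => _; last first.
  by rewrite lee_fin mulr_ge0// fine_ge0// Lp_mass_ge0.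
have M0 : 0 <= fine (Lp_mass 1 f) by rewrite fine_ge0// Lp_mass_ge0.
apply/ess_supP; apply: aeW => rho /=.
rewrite patchE; case: ifPn => [/set_mem/Rpos_gt0 rho0|_]; last first.
  by rewrite abse0 lee_fin mulr_ge0.
rewrite (@angular_max_best _ _ _ mre mim _ _ f rho (re_partE f) (im_partE f) rho0); last 2 first.
- by move=> e e0; exact: part_decay_integrable le11 f1 _ _ mre (re_part_le f) e0.
- by move=> e e0; exact: part_decay_integrable le11 f1 _ _ mim (im_part_le f) e0.
rewrite gee0_abs; last first.
  apply: (@le_trans _ _ (arc_abs (re_part f) (im_part f) rho
     (best_angle (re_part f) (im_part f) 0 rho))%:E); first by rewrite lee_fin sqrtr_ge0.
  by apply: ereal_sup_ubound; exists 0%N.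
apply: ge_ereal_sup => _ [J _ <-]; rewrite lee_fin.
apply: le_trans (lap_abs_le _ _ _ _) _.
have x0 : 0 <= rho * cos (best_angle (re_part f) (im_part f) J rho).
  by rewrite mulr_ge0 ?ltW// cos_gt0_arc// best_angle_range.
have b1 b := le_trans (lap_part_le b
  (rho * sin (best_angle (re_part f) (im_part f) J rho)) mre (lexx _) x0 ire) nre.
have b2 b := le_trans (lap_part_le b
  (rho * sin (best_angle (re_part f) (im_part f) J rho)) mim (lexx _) x0 iim) nim.
have := b1 true; have := b1 false; have := b2 true; have := b2 false.
lra.
Qed.

Lemma hoelder_conj_exp (p : R) : 1 < p ->
  hoelder_conjugate p%:E = (conj_exp p)%:E.
Proof.
move=> p1; have pm : p - 1 != 0 by rewrite gt_eqF// subr_gt0.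
have p0 : p != 0 by rewrite gt_eqF// (lt_trans _ p1).
by rewrite /hoelder_conjugate eqe (negbTE p0) /conj_exp -EFinB inver (negbTE pm) -EFinM.
Qed.

(** The bound of [arc_linearized_bound] is uniform over the intervals and the angle
choices, so it passes to the increasing limit over the intervals
[1 / (J + 1), J + 1] and the angles [best_angle J]. *)
Lemma angular_max_Lp (p : R) f : 1 < p <= 2 -> Lp_pos p%:E f ->
  (\int[mu]_rho (`|(angular_max_laplace f \_ Rpos) rho| `^ (conj_exp p)) <=
   (4 `^ (conj_exp p) * (4 * strong_cst p) *
     fine (Lp_mass p f) `^ (conj_exp p - 1))%:E)%E.
Proof.
move=> p12 fp; have [p1 p2] := andP p12.
set q := conj_exp p; set B := (X in (_ <= X)%E).
have mre := measurable_re_part fp; have mim := measurable_im_part fp.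
have q1 : 0 < q.
  by rewrite /q /conj_exp divr_gt0 ?subr_gt0// (lt_trans _ p1).
pose h J rho := arc_abs (re_part f) (im_part f) rho
  (best_angle (re_part f) (im_part f) J rho).
have h0 J rho : 0 <= h J rho by exact: sqrtr_ge0.
have hnd rho : {homo (fun J => h J rho) : i j / (i <= j)%N >-> i <= j}.
  exact: arc_abs_best_nd.
have mh J : measurable_fun [set: R] (h J).
  by apply: measurable_arc_abs => //; exact: measurable_best_angle.
have hE J rho : h J rho = arc_abs (re_part f) (im_part f) rho
    (best_angle (re_part f) (im_part f) J rho) by [].
clearbody h.
pose E J : set R := `[(J.+1%:R)^-1, J.+1%:R]%classic.
have mE J : measurable (E J) by exact: measurable_itv.
have EP J : E J = `[(J.+1%:R)^-1, J.+1%:R]%classic by [].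
clearbody E.
pose G J rho : \bar R := (\1_(E J) rho * h J rho `^ q)%:E.
have indE (A : set R) (r : R) : 0 <= (\1_A r : R) by case/andP: (indic01 R A r).
have G0 J rho : [set: R] rho -> (0 <= G J rho)%E.
  by move=> _; rewrite lee_fin mulr_ge0// powR_ge0.
have mG J : measurable_fun [set: R] (G J).
  apply/measurable_EFinP; apply: measurable_funM; first exact: measurable_indic.
  exact: (measurableT_comp (measurable_powR q)).
have EE i j : (i <= j)%N -> E i `<=` E j.
  move=> ij r; rewrite !EP /= !in_itv /= => /andP[r1 r2].
  have ij' : (i.+1%:R : R) <= j.+1%:R by rewrite ler_nat.
  rewrite (le_trans r2 ij') andbT; apply: le_trans r1.
  by rewrite lef_pV2 ?posrE.
have ERpos J r : E J r -> Rpos r.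
  rewrite EP /Rpos /= !in_itv /= andbT => /andP[r1 _].
  by apply: lt_le_trans r1; rewrite invr_gt0.
have Gnd rho : [set: R] rho -> nondecreasing_seq (G ^~ rho).
  move=> _ i j ij; rewrite lee_fin.
  have [ri|ri] := pselect (E i rho); last first.
    have -> : \1_(E i) rho = 0 :> R by rewrite indicE memNset.
    by rewrite mul0r; apply: mulr_ge0; [exact: indE|exact: powR_ge0].
  have rj : E j rho by exact: EE ri.
  rewrite !indicE !mem_set// !mul1r.
  by apply: ge0_ler_powR; [exact: ltW|exact: h0|exact: h0|exact: hnd].
have ge0_itv (s : \bar R) : (0 <= s)%E -> s \in `[0%E, +oo%E].
  by move=> s0; rewrite in_itv /= s0 leey.
have angE rho : (`|(angular_max_laplace f \_ Rpos) rho| `^ q = limn (G ^~ rho))%E.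
  have -> : limn (G ^~ rho) = ereal_sup (range (G ^~ rho)).
    by apply/cvg_lim => //; apply: ereal_nondecreasing_cvgn; exact: Gnd.
  rewrite patchE; case: ifPn => [/set_mem/Rpos_gt0 rho0|rhoN]; last first.
    rewrite abse0 poweR0r ?gt_eqF//.
    have Gout J : G J rho = 0%E.
      by rewrite /G indicE memNset ?mul0r// => /ERpos rp; rewrite mem_set in rhoN.
    have -> : range (G ^~ rho) = [set 0%E].
      by apply/seteqP; split => [_ [J _ <-]|_ ->] /=; [exact: Gout|exists 0%N].
    by rewrite ereal_sup1.
  rewrite (@angular_max_best _ _ _ mre mim _ _ f rho (re_partE f) (im_partE f) rho0);
    last 2 first.
  - by move=> e e0; exact: part_decay_integrable (ltW p1) fp _ _ mre (re_part_le f) e0.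
  - by move=> e e0; exact: part_decay_integrable (ltW p1) fp _ _ mim (im_part_le f) e0.
  have -> : (fun J => (arc_abs (re_part f) (im_part f) rho
      (best_angle (re_part f) (im_part f) J rho))%:E) = (fun J => (h J rho)%:E).
    by apply/funext => J; rewrite hE.
  set S := ereal_sup _; set L := ereal_sup (range (G ^~ rho)).
  have hS J : ((h J rho)%:E <= S)%E by apply: ereal_sup_ubound; exists J.
  have GL J : (G J rho <= L)%E by apply: ereal_sup_ubound; exists J.
  have S0 : (0 <= S)%E by apply: le_trans (hS 0%N); rewrite lee_fin.
  have L0 : (0 <= L)%E by apply: le_trans (GL 0%N); exact: G0.
  rewrite gee0_abs//; apply/eqP; rewrite eq_le; apply/andP; split; last first.
    apply: ge_ereal_sup => _ [J _ <-].
    apply: (@le_trans _ _ ((h J rho)%:E `^ q)%E).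
      by rewrite poweR_EFin lee_fin ler_piMl ?powR_ge0.
    by apply: gt0_ler_poweR; rewrite ?(ltW q1)//; apply: ge0_itv => //; rewrite lee_fin.
  (* Comparing q-th roots avoids a separate case S = +oo. *)
  have SL : (S <= L `^ q^-1)%E.
    apply: ge_ereal_sup => _ [J _ <-].
    have [J' JJ' EJ'] : exists2 J', (J <= J')%N & E J' rho.
      have : \forall n \near \oo, (J <= n)%N /\ E n rho.
        near=> n; split; first by near: n; exact: nbhs_infty_ge.
        rewrite EP /= in_itv /=; apply/andP; split.
          rewrite invf_ple ?posrE//; apply: (@le_trans _ _ n%:R); last by rewrite ler_nat.
          by near: n; exact: nbhs_infty_ger.
        apply: (@le_trans _ _ n%:R); last by rewrite ler_nat.
        by near: n; exact: nbhs_infty_ger.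
      by move=> /filter_ex[n [h1 h2]]; exists n.
    apply: (@le_trans _ _ ((h J' rho)%:E)); first by rewrite lee_fin; exact: hnd.
    have -> : (h J' rho)%:E = (G J' rho `^ q^-1)%E.
      rewrite /G indicE mem_set// mul1r -poweR_EFin -poweRrM mulfV ?gt_eqF//.
      by rewrite poweRe1// lee_fin.
    apply: gt0_ler_poweR; rewrite ?invr_ge0 ?(ltW q1)//; apply: ge0_itv => //.
    exact: G0.
  apply: (@le_trans _ _ ((L `^ q^-1) `^ q)%E).
    by apply: gt0_ler_poweR; rewrite ?(ltW q1)//; apply: ge0_itv => //; exact: poweR_ge0.
  by rewrite -poweRrM mulVf ?gt_eqF// poweRe1.
under eq_integral do rewrite angE.
rewrite (monotone_convergence mu measurableT mG G0 Gnd).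
apply: lime_le.
  apply: ereal_nondecreasing_is_cvgn => i j ij.
  by apply: (ge0_le_integral mu measurableT);
    [exact: G0|exact: mG|exact: mG|move=> r ?; exact: Gnd].
apply: nearW => J; rewrite /G integral_indicM EP.
under eq_integral do rewrite hE /arc_abs.
have [c c0 cP] := best_angle_cos (re_part f) (im_part f) J.
have Mfin := Lp_mass_fin (ltW p1) fp.
have uA : (\int[mu]_t (`|re_part f t| `^ p)%:E <= (fine (Lp_mass p f))%:E)%E.
  by rewrite fineK//; exact: part_mass_le (ltW p1) fp _ mre (re_part_le f).
have vA : (\int[mu]_t (`|im_part f t| `^ p)%:E <= (fine (Lp_mass p f))%:E)%E.
  by rewrite fineK//; exact: part_mass_le (ltW p1) fp _ mim (im_part_le f).
have mbest := measurable_best_angle mre mim J.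
have J0 : 0 < (J.+1%:R)^-1 :> R by rewrite invr_gt0.
exact: (arc_linearized_bound _ p12 mre mim uA vA mbest c0 cP J0).
Unshelve. all: end_near. Qed.
End final.

Theorem theorem4 (R : realType) (p : R) (hp : 1 <= p <= 2) :
  exists K4 : R, forall f : R -> R[i], Lp_pos p%:E f ->
    (Lnorm_pos (hoelder_conjugate p%:E) (angular_max_laplace f)
     <= K4%:E * Lnorm_pos p%:E (fun t => (cabs (f t))%:E))%E.
Proof.
have [p1 p2] := andP hp.
have [pE|pN] := eqVneq p 1.
  by exists 4 => f; rewrite pE hoelder_conjugate1; exact: angular_max_L1.
have {pN}p1 : 1 < p by rewrite lt_neqAle eq_sym pN.
have p12 : 1 < p <= 2 by rewrite p1.
set q := conj_exp p.
have q0 : 0 < q by rewrite /q /conj_exp divr_gt0 ?subr_gt0// (lt_trans _ p1).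
pose C := 4 `^ q * (4 * strong_cst p).
have C0 : 0 <= C.
  by rewrite mulr_ge0 ?powR_ge0// mulr_ge0// strong_cst_ge0.
exists (C `^ q^-1) => f fp; rewrite hoelder_conj_exp// Lnorm_posE.
have Mfin := Lp_mass_fin (ltW p1) fp; have M0 := Lp_mass_ge0 p f.
rewrite -(fineK Mfin) poweR_EFin -EFinM.
have -> : C `^ q^-1 * fine (Lp_mass p f) `^ p^-1 =
    (C * fine (Lp_mass p f) `^ (q - 1)) `^ q^-1.
  rewrite powRM ?powR_ge0// -powRrM; congr (_ * _ `^ _).
  by rewrite /q /conj_exp; field; rewrite !gt_eqF ?subr_gt0// (lt_trans _ p1).
rewrite -poweR_EFin /Lnorm_pos unlock.
apply: gt0_ler_poweR; rewrite ?invr_ge0 ?(ltW q0)//.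
- rewrite in_itv /= leey andbT; apply: integral_ge0 => r _; exact: poweR_ge0.
- by rewrite in_itv /= leey andbT lee_fin mulr_ge0 ?powR_ge0.
- exact: angular_max_Lp.
Qed.
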